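(* There exist absolute constants $c'>0$ and $C>0$ such that for all integers $N\ge2$, $$K_6(N)\le C(\log N)^{c'}.$$
   Context: For $p\ge 1$ and an integer $N$, $K_p(N)$ denotes the smallest constant such that for all complex sequences $\{a_n\}_{n\in\mathbb{Z},|n|\le N}$, $$\Big\|\sum_{|n|\le N}a_ne^{2\pi i(nx+n^2t)}\Big\|_{L^p(\mathbb{T}^2)}\le K_p(N)\Big(\sum_{|n|\le N}|a_n|^2\Big)^{1/2},$$ where $(x,t)\in\mathbb{T}^2=(\mathbb{R}/\mathbb{Z})^2$. *)

(* Defs.v *)
From mathcomp Require Import all_boot all_order all_algebra complex.
From mathcomp Require Import all_classical all_reals all_analysis.

Set Implicit Arguments.
Unset Strict Implicit.
Unset Printing Implicit Defensive.

Import Order.TTheory GRing.Theory Num.Theory.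
Import ComplexField.Normc.

Local Open Scope classical_set_scope.
Local Open Scope ring_scope.

Section Torus.
Variable R : realType.

(* Functions on T = R/Z are represented on the fundamental domain [0, 1[;
   T^2 carries its normalized Haar measure. *)
Lemma measurable_unit_square :
  measurable (`[0, 1[%classic `*` `[0, 1[%classic
    : set (measurableTypeR R * measurableTypeR R)).
Proof. exact: measurableX. Qed.

Definition torus2_measure :
    {measure set (measurableTypeR R * measurableTypeR R) -> \bar R} :=
  mrestr (lebesgue_measure \x lebesgue_measure)%E measurable_unit_square.

(* [normc] is the R-valued modulus on R[i]. *)
Definition torus2_Lnorm (p : R) (f : R * R -> R[i]) : \bar R :=
  Lnorm torus2_measure p%:E (fun z => (normc (f z))%:E).

(* exp(2 pi i x) *)
Definition expi2pi (x : R) : R[i] := Complex (cos (2 * pi * x)) (sin (2 * pi * x)).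

End Torus.

Definition freqs (N : nat) : seq int :=
  [seq k%:Z - N%:Z | k <- iota 0 (N.*2).+1].

Lemma freqs_uniq N : uniq (freqs N).
Proof. by rewrite map_inj_uniq ?iota_uniq// => i j /addIr[]. Qed.

Lemma mem_freqs N (n : int) : (n \in freqs N) = (`|n| <= N%:Z).
Proof.
apply/mapP/idP => [[k]|].
  rewrite mem_iota add0n ltnS => /andP[_ kN] ->.
  by rewrite ler_norml lerBrDr addNr lerBlDr -PoszD addnn !lez_nat kN.
rewrite ler_norml => /andP[Nn nN].
have nN0 : 0 <= n + N%:Z by rewrite -lerBlDr sub0r.
exists (absz (n + N%:Z)); last by rewrite gez0_abs// addrK.
by rewrite mem_iota leq0n add0n ltnS -addnn -lez_nat PoszD gez0_abs// lerD2r.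
Qed.

Section Strichartz.
Variable R : realType.

Definition quad_exp_sum (N : nat) (a : int -> R[i]) (z : R * R) : R[i] :=
  \sum_(n <- freqs N) a n * expi2pi (n%:~R * z.1 + n%:~R ^+ 2 * z.2).

Definition l2norm (N : nat) (a : int -> R[i]) : R :=
  Num.sqrt (\sum_(n <- freqs N) normc (a n) ^+ 2).

Definition strichartz_bounds (p : R) (N : nat) : set R :=
  [set K | forall a : int -> R[i],
    (torus2_Lnorm p (quad_exp_sum N a) <= (K * l2norm N a)%:E)%E].

Definition strichartz_const (p : R) (N : nat) : \bar R :=
  ereal_inf [set K%:E | K in strichartz_bounds p N].

(* The infimum is attained, so it is the smallest admissible constant. *)
Lemma strichartz_constP (p : R) (N : nat) (a : int -> R[i]) : 1 <= p ->
  (torus2_Lnorm p (quad_exp_sum N a)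
     <= strichartz_const p N * (l2norm N a)%:E)%E.
Proof.
move=> p1; have [l0|l0] := eqVneq (l2norm N a) 0.
  have a0 n : n \in freqs N -> a n = 0.
    move=> nN; apply: eq0_normc; apply/eqP; rewrite -sqrf_eq0.
    have /eqP : \sum_(n <- freqs N) normc (a n) ^+ 2 = 0.
      apply/eqP; rewrite eq_le -sqrtr_eq0 -/(l2norm N a) l0 eqxx/=.
      by apply: sumr_ge0 => i _; exact: sqr_ge0.
    by rewrite psumr_eq0 => [/allP/(_ _ nN)//|i _]; exact: sqr_ge0.
  rewrite l0 mule0 /torus2_Lnorm.
  have -> : (fun z => (normc (quad_exp_sum N a z))%:E) = cst 0%E :> (R * R -> \bar R).
    apply/funext => z; rewrite /quad_exp_sum big_seq big1 ?normc0// => n nN.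
    by rewrite a0// mul0r.
  by rewrite Lnorm0// eqe gt_eqF// (lt_le_trans ltr01).
have lp : 0 < l2norm N a by rewrite lt_neqAle eq_sym l0 sqrtr_ge0.
rewrite -lee_pdivrMr//; apply: le_ereal_inf_tmp => _ [K KN <-].
by rewrite lee_pdivrMr// -EFinM.
Qed.

End Strichartz.

(* Main.v *)
Require Import Defs.
From mathcomp Require Import all_boot all_order all_algebra.
From mathcomp Require Import cyclic complex zify ring lra.

(** A high-low argument in the p-adic setting (after Guth-Maldague-Wang and
Guo-Li-Yung), with p = 3. Averaging over the translates of a point by the grid
(Z/q)^2, q = p^(2K) with p^K > 2N, replaces the torus by the finite group (Z/q)^2.
There the uncertainty principle is exact: the part f_(j,c) of the sum with
n = c mod p^j has constant modulus on the cosets of a subgroup (a tile). Hence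
the square functions g_j = sum_c |f_(j,c)|^2 form a reversed martingale, the average
of g_j over p-adic balls of the next scale being g_(j+1), and the differences
|f_(j,c)|^2 - average are pairwise orthogonal in c, since the tiles of two classes
together generate the ball.

A broad-narrow decomposition and parabolic rescaling reduce the sixth moment to two
parts that are transversal mod p. For these the sets {|f_1|, |f_2| >= beta} are
bounded as follows. Prune all packets of amplitude larger than lam ~ K A / beta, where
A is the squared l^2 norm. Split the points by the last scale j at which the high part
g_j - average exceeds A / K: beyond j all g_l are at most 2A, so that the pruning
changes f_1 and f_2 by at most beta / 2, the bilinear estimate at scale j bounds
beta^4 by the average of g_j^2, and orthogonality with |f_(j,c)| <= lam bounds the
measure of the set of such points by a multiple of lam^2 K^2 / A. All losses are powers
of K ~ log N. *)

Set Implicit Arguments.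
Unset Strict Implicit.
Unset Printing Implicit Defensive.

Import Order.TTheory GRing.Theory Num.Theory.
Import ComplexField.Normc.

Local Open Scope ring_scope.

(** * Complex moduli, Cauchy-Schwarz and Parseval *)

Section ComplexModulus.
Variable R : rcfType.
Implicit Types z w : R[i].

Lemma normcE z : `|z| = (normc z)%:C%C.
Proof. by case: z. Qed.

Lemma normc_ge0 z : 0 <= normc z.
Proof. by case: z => x y; exact: sqrtr_ge0. Qed.

Lemma normc_sqrE z : (normc z ^+ 2)%:C%C = z * (z^*)%C.
Proof. by rewrite -sqr_normc normcE rmorphXn. Qed.

Lemma le_normc_sum (I : Type) (r : seq I) (P : pred I) (F : I -> R[i]) :
  normc (\sum_(i <- r | P i) F i) <= \sum_(i <- r | P i) normc (F i).
Proof.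
elim/big_rec2: _ => [|i x y _ le_yx]; first by rewrite normc0.
by apply: le_trans (le_normcD _ _) _; rewrite lerD2l.
Qed.

Lemma sum_sqr_ge0 (I : Type) (r : seq I) (P : pred I) (F : I -> R[i]) :
  0 <= \sum_(i <- r | P i) normc (F i) ^+ 2.
Proof. by apply: sumr_ge0 => i _; exact: sqr_ge0. Qed.

(** Lagrange's identity: the double sum of [(u i - u j) ^+ 2] is twice the difference of the two
    sides. *)
Lemma sqr_sum_le n (u : 'I_n -> R) :
  (\sum_i u i) ^+ 2 <= n%:R * \sum_i u i ^+ 2.
Proof.
have H : 0 <= \sum_i \sum_j (u i - u j) ^+ 2.
  by apply: sumr_ge0 => i _; apply: sumr_ge0 => j _; exact: sqr_ge0.
have E : \sum_i \sum_j (u i - u j) ^+ 2 =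
    2 * (n%:R * \sum_i u i ^+ 2 - (\sum_i u i) ^+ 2).
  transitivity (\sum_i (n%:R * u i ^+ 2 + \sum_j u j ^+ 2 - 2 * u i * \sum_j u j)).
    apply: eq_bigr => i _.
    rewrite mulr_sumr mulr_natl -[X in _ *+ X](card_ord n) -sumr_const.
    rewrite -big_split -sumrB /=; apply: eq_bigr => j _; ring.
  rewrite sumrB big_split /= sumr_const card_ord -!mulr_suml -!mulr_sumr.
  by rewrite -mulr_natl; ring.
by rewrite E pmulr_rge0// subr_ge0 in H.
Qed.

Lemma normc_sum_sqr_le n (F : 'I_n -> R[i]) :
  normc (\sum_i F i) ^+ 2 <= n%:R * \sum_i normc (F i) ^+ 2.
Proof.
apply: le_trans (sqr_sum_le _); rewrite lerXn2r ?nnegrE ?normc_ge0//.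
  by apply: sumr_ge0 => i _; exact: normc_ge0.
exact: le_normc_sum.
Qed.

(** Parseval on [B]: expanding the square leaves only the diagonal terms, and each [psi i] is
    unimodular. *)
Lemma orthogonal_sum_sqr (T I : finType) (B : {set T}) (P : pred I)
    (psi : I -> T -> R[i]) (w : I -> R[i]) :
  (forall i b, b \in B -> normc (psi i b) = 1) ->
  (forall i j, P i -> P j -> i != j ->
     \sum_(b in B) psi i b * ((psi j b)^*)%C = 0) ->
  \sum_(b in B) normc (\sum_(i | P i) w i * psi i b) ^+ 2 =
  #|B|%:R * \sum_(i | P i) normc (w i) ^+ 2.
Proof.
move=> psi1 psi_orth; apply: (@complexI R).
rewrite rmorph_sum rmorphM rmorph_nat rmorph_sum mulr_sumr /=.
under eq_bigr => b _ do rewrite normc_sqrE rmorph_sum /= big_distrl /=.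
rewrite exchange_big; apply: eq_bigr => i Pi.
under eq_bigr => b _ do rewrite big_distrr /= (bigD1 i)//=.
rewrite big_split /= [X in _ + X]exchange_big /= [X in _ + X]big1 ?addr0.
  rewrite -sum1_card natr_sum mulr_suml; apply: eq_bigr => b bB.
  by rewrite -normc_sqrE normcM psi1// mulr1 mul1r.
move=> j /andP[Pj ji].
under eq_bigr => b _ do rewrite rmorphM /= mulrACA.
by rewrite -mulr_sumr psi_orth ?mulr0// eq_sym.
Qed.

End ComplexModulus.

(** * Arithmetic in Z/q *)

Section Zmod.
Variable q : nat.
Hypothesis q_gt1 : (1 < q)%N.

Lemma natr_Zq_eq0 n : (n%:R == 0 :> 'Z_q) = (q %| n)%N.
Proof. by rewrite -val_eqE /= val_Zp_nat. Qed.

Lemma natr_Zq_eq0_pow p M n : q = (p ^ M)%N -> (M <= n)%N ->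
  (p ^ n)%:R = 0 :> 'Z_q.
Proof. by move=> qE Mn; apply/eqP; rewrite natr_Zq_eq0 qE dvdn_exp2l. Qed.

Local Notation G := ('Z_q * 'Z_q)%type.

Lemma sum_shift (T : nmodType) (B : {set G}) (F : G -> T) (b0 : G) :
  (forall b : G, (b + b0 \in B) = (b \in B)) ->
  \sum_(b in B) F (b + b0) = \sum_(b in B) F b.
Proof.
move=> BD; rewrite [RHS](reindex_inj (addIr b0)) /=.
by apply: eq_bigl => b; rewrite BD.
Qed.

Lemma sum_shiftT (T : nmodType) (F : G -> T) (b0 : G) :
  \sum_(b : G) F (b + b0) = \sum_(b : G) F b.
Proof. by rewrite [RHS](reindex_inj (addIr b0)). Qed.

Variable p : nat.
Hypotheses (p_prime : prime p) (p_odd : odd p).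

(** Since [p * y = 0], [y] is a multiple of [p ^ M.-1], and dividing by the [p]-part of [d * p ^ a]
    stays integral. The power of [p] in the solution is kept explicit because the tile decomposition
    needs its divisibility. *)
Lemma linear_solution (M a y d : nat) : q = (p ^ M)%N ->
  (0 < d)%N -> (logn p d + a < M)%N -> (p * y)%:R = 0 :> 'Z_q ->
  exists s' : nat, (2 * d * p ^ a * (p ^ (M.-1 - logn p d - a) * s'))%:R = y%:R :> 'Z_q.
Proof.
move=> qE d_gt0 vaM /eqP; rewrite natr_Zq_eq0 => qy.
rewrite {1}qE in qy.
have [w pw dE] := pfactor_coprime p_prime d_gt0.
set v := logn p d in vaM dE *.
have M_gt0 : (0 < M)%N by lia.
have /dvdnP[y' yE] : (p ^ M.-1 %| y)%N.
  by rewrite -(prednK M_gt0) expnS dvdn_pmul2l ?prime_gt0 // in qy.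
have p2w : coprime p (2 * w).
  by rewrite coprimeMr pw andbT prime_coprime // dvdn_prime2 //; apply: contraTneq p_odd => ->.
(* By Euler's theorem the power of [2 * w] is its inverse mod [p]. *)
exists (y' * (2 * w) ^ (totient p).-1)%N.
apply/eqP; rewrite -val_eqE /= !val_Zp_nat // yE [in X in X == _]dE.
have -> : (2 * (w * p ^ v) * p ^ a *
    (p ^ (M.-1 - v - a) * (y' * (2 * w) ^ (totient p).-1)) =
    p ^ M.-1 * (y' * (2 * w) ^ totient p))%N.
  have -> : (p ^ M.-1 = p ^ v * p ^ a * p ^ (M.-1 - v - a))%N.
    by rewrite -!expnD; congr (p ^ _)%N; lia.
  have -> : ((2 * w) ^ totient p = (2 * w) * (2 * w) ^ (totient p).-1)%N.
    by rewrite -expnS prednK // totient_gt0 prime_gt0.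
  by ring.
have qE2 : q = (p ^ M.-1 * p)%N.
  by rewrite mulnC -expnS prednK.
rewrite {1 2}qE2.
rewrite (mulnC y') -!muln_modr (mulnC y') -modnMml.
by rewrite Euler_exp_totient 1?coprime_sym // modnMml mul1n muln_modr.
Qed.

End Zmod.

(** Eliminating [c2 - d2] leaves [(c1 - d1) * (c1 + d1 - c2 - d2)]; the second factor is
    [2 * (c1 - c2)] mod [p], hence prime to [p] by transversality. *)
Lemma dvdz_quadratic_system (p j : nat) (c1 c2 d1 d2 : int) :
  prime p -> odd p ->
  (p %| c1 - d1)%Z -> (p %| c2 - d2)%Z -> ~~ (p %| c1 - c2)%Z ->
  ((p ^ j)%N %| c1 + c2 - (d1 + d2))%Z ->
  ((p ^ j)%N %| c1 ^+ 2 + c2 ^+ 2 - (d1 ^+ 2 + d2 ^+ 2))%Z ->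
  ((p ^ j)%N %| c1 - d1)%Z.
Proof.
move=> p_prime p_odd p1 p2 p12 s1 s2.
have cop : coprimez (p ^ j)%N (c1 + d1 - c2 - d2).
  rewrite coprimezE absz_nat coprimeXl // prime_coprime //.
  apply: contra p12 => p12; have {}p12 : (p %| c1 + d1 - c2 - d2)%Z by [].
  have : (p %| 2 * (c1 - c2))%Z.
    rewrite (_ : 2 * (c1 - c2) = (c1 + d1 - c2 - d2) + (c1 - d1) - (c2 - d2)).
      by rewrite rpredB // rpredD.
    by ring.
  rewrite Gauss_dvdzr // coprimezE prime_coprime //.
  by rewrite dvdn_prime2 //; apply: contraTneq p_odd => /= pE; rewrite (pE : p = 2)%N.
rewrite -(Gauss_dvdzl _ cop).
rewrite (_ : _ * _ = (c1 ^+ 2 + c2 ^+ 2 - (d1 ^+ 2 + d2 ^+ 2))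
   - (c1 + c2 - (d1 + d2)) * (c2 + d2)); last by ring.
by rewrite rpredB // dvdz_mulr.
Qed.

Lemma sum_digits (V : nmodType) (m n : nat) (F : nat -> V) :
  \sum_(c < m * n) F c = \sum_(c < m) \sum_(d < n) F (c + m * d)%N.
Proof.
rewrite mulnC -(big_mkord xpredT F) big_nat_mul big_mkord exchange_big /=.
apply: eq_bigr => d _; rewrite mulSn -{1}[(d * m)%N]add0n big_addn addnK big_mkord.
by apply: eq_bigr => c _; rewrite mulnC.
Qed.

(** * Pruned wave packets and square functions *)

Section Wavepackets.
Variables (R : rcfType) (p i k q : nat).
Hypotheses (p_prime : prime p) (p_odd : odd p).
Hypotheses (q_gt1 : (1 < q)%N) (qE : q = (p ^ (2 * (i + k)))%N).
Local Notation Z := 'Z_q.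
Local Notation G := (Z * Z)%type.

(** An abstract faithful unitary character keeps this part purely algebraic; [zq_char] is
    substituted for it at the end. *)
Variable e : Z -> R[i].
Hypothesis eD : forall x y, e (x + y) = e x * e y.
Hypothesis e_norm : forall x, normc (e x) = 1.
Hypothesis e_inj : forall x, e x = 1 -> x = 0.

Lemma char0 : e 0 = 1.
Proof.
have e0_neq0 : e 0 != 0.
  by apply/eqP => e00; have := e_norm 0; rewrite e00 normc0 => /esym/eqP; rewrite oner_eq0.
by apply: (mulfI e0_neq0); rewrite -eD addr0 mulr1.
Qed.

Lemma char_conj x : ((e x)^*)%C = e (- x).
Proof.
have ex_neq0 : e x != 0.
  by apply/eqP => ex0; have := e_norm x; rewrite ex0 normc0 => /esym/eqP; rewrite oner_eq0.
apply: (mulfI ex_neq0); rewrite -eD subrr char0 -normc_sqrE e_norm expr1n.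
by [].
Qed.

(** * Characters along the parabola, tiles and balls *)

Let D : Z := (p ^ i)%:R.
Let P (j : nat) : Z := (p ^ j)%:R.

Let PS j : P j.+1 = p%:R * P j.
Proof. by rewrite /P expnS natrM. Qed.

(* The factor [D = p ^ i] records [i] parabolic rescalings: the sums at stage [i] have
   frequencies [(D n, D ^ 2 n ^ 2)] with [n < p ^ k]. *)
Definition chi (c : nat) (y : G) : R[i] :=
  e (D * c%:R * y.1 + (D * c%:R) ^+ 2 * y.2).

(* The subgroup dual to the class [c + p ^ j Z]: all characters [chi n] with [n] in this
   class agree on it, see [chi_tile]. *)
Definition tile (j c : nat) (y : G) : bool :=
  (P j * D * (y.1 + 2 * c%:R * D * y.2) == 0) && ((P j * D) ^+ 2 * y.2 == 0).

(** This ball lies in the tile of every class mod [p ^ j], so on it [chi c] depends only on [c] mod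
    [p ^ j]. *)
Definition pball (j : nat) : {set G} :=
  [set y : G | (P j * D * y.1 == 0) && (P j * D ^+ 2 * y.2 == 0)].

Lemma chiD c y y' : chi c (y + y') = chi c y * chi c y'.
Proof. by rewrite /chi -eD /=; congr e; ring. Qed.

Lemma chi_norm c y : normc (chi c y) = 1.
Proof. exact: e_norm. Qed.

Lemma chi_tile j c d h : tile j c h -> chi (c + p ^ j * d) h = chi c h.
Proof.
case/andP => /eqP h1 /eqP h2; rewrite /chi natrD natrM -/(P j); congr e.
transitivity (D * c%:R * h.1 + (D * c%:R) ^+ 2 * h.2
  + d%:R * (P j * D * (h.1 + 2 * c%:R * D * h.2))
  + d%:R ^+ 2 * ((P j * D) ^+ 2 * h.2)); first by ring.
by rewrite h1 h2 !mulr0 !addr0.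
Qed.

(** Tiles grow as frequency classes shrink; this lets a symmetry of a packet pass through all its
    descendants. *)
Lemma tile_child j c d h : tile j c h -> tile j.+1 (c + p ^ j * d) h.
Proof.
case/andP => /eqP h1 /eqP h2; rewrite /tile natrD natrM -/(P j) PS.
apply/andP; split; apply/eqP.
  transitivity (p%:R * (P j * D * (h.1 + 2 * c%:R * D * h.2))
    + 2 * p%:R * d%:R * ((P j * D) ^+ 2 * h.2)); first by ring.
  by rewrite h1 h2 !mulr0 addr0.
transitivity (p%:R ^+ 2 * ((P j * D) ^+ 2 * h.2)); first by ring.
by rewrite h2 mulr0.
Qed.

Lemma pball_tile j c y : y \in pball j -> tile j c y.
Proof.
rewrite inE => /andP[/eqP y1 /eqP y2]; apply/andP; split; apply/eqP.
  transitivity (P j * D * y.1 + 2 * c%:R * (P j * D ^+ 2 * y.2)); first by ring.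
  by rewrite y1 y2 mulr0 addr0.
transitivity (P j * (P j * D ^+ 2 * y.2)); first by ring.
by rewrite y2 mulr0.
Qed.

Lemma pball_le j l y : (j <= l)%N -> y \in pball j -> y \in pball l.
Proof.
move=> /subnK <-; rewrite !inE => /andP[/eqP y1 /eqP y2].
rewrite /P expnD natrM -/(P j); apply/andP; split; apply/eqP.
  transitivity ((p ^ (l - j))%:R * (P j * D * y.1)); first by ring.
  by rewrite y1 mulr0.
transitivity ((p ^ (l - j))%:R * (P j * D ^+ 2 * y.2)); first by ring.
by rewrite y2 mulr0.
Qed.

Lemma pball_shift j b0 : b0 \in pball j -> forall b : G, (b + b0 \in pball j) = (b \in pball j).
Proof.
rewrite inE => /andP[/eqP y1 /eqP y2] b.
by rewrite !inE !mulrDr y1 y2 !addr0.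
Qed.

Lemma card_pball_gt0 j : (0 < #|pball j|)%N.
Proof. by apply/card_gt0P; exists 0; rewrite inE !mulr0 eqxx. Qed.

(** Translation by [b0] multiplies the sum by [psi b0]. *)
Lemma sum_char_eq0 j (psi : G -> R[i]) b0 :
  b0 \in pball j -> (forall b b', psi (b + b') = psi b * psi b') -> psi b0 != 1 ->
  \sum_(b in pball j) psi b = 0.
Proof.
move=> b0B psiD b01; have := sum_shift psi (pball_shift b0B).
under eq_bigr => b _ do rewrite psiD.
rewrite -mulr_suml => /eqP; rewrite -subr_eq0 -[X in _ - X]mulr1 -mulrBr mulf_eq0.
by rewrite subr_eq0 (negPf b01) orbF => /eqP.
Qed.

(** Two test points of the ball, where [chi c] reads off [c] and [c ^ 2] mod [p ^ j]
    respectively. *)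
Let x_probe j : G := ((p ^ (2 * (i + k) - j - i))%:R, 0).
Let t_probe j : G := (0, (p ^ (2 * (i + k) - j - 2 * i))%:R).

Lemma x_probe_pball j : (j <= k)%N -> x_probe j \in pball j.
Proof.
move=> jk; rewrite inE /= mulr0 eqxx andbT /P /D -!natrM -!expnD.
by apply/eqP/(natr_Zq_eq0_pow q_gt1 qE); lia.
Qed.

Lemma t_probe_pball j : (j <= k)%N -> t_probe j \in pball j.
Proof.
move=> jk; rewrite inE /= mulr0 eqxx /= /P /D -natrX -!natrM -expnM -!expnD.
by apply/eqP/(natr_Zq_eq0_pow q_gt1 qE); lia.
Qed.

Lemma natr_Zq_eq_mod m n j l : (j + l = 2 * (i + k))%N ->
  ((m * p ^ l)%:R == (n * p ^ l)%:R :> Z) = (m == n %[mod p ^ j])%N.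
Proof.
move=> jl; rewrite -val_eqE /= !val_Zp_nat // qE -jl expnD -!muln_modl.
by rewrite eqn_pmul2r // expn_gt0 prime_gt0.
Qed.

Lemma chi_x_probe c j : (j <= k)%N -> chi c (x_probe j) = e (c * p ^ (2 * (i + k) - j))%:R.
Proof.
move=> jk; rewrite /chi /= mulr0 addr0; congr e.
rewrite /D -mulrA mulrCA -!natrM -expnD; congr (_ * p ^ _)%:R; lia.
Qed.

Lemma chi_t_probe c j : (j <= k)%N ->
  chi c (t_probe j) = e (c ^ 2 * p ^ (2 * (i + k) - j))%:R.
Proof.
move=> jk; rewrite /chi /= mulr0 add0r; congr e.
rewrite /D exprMn mulrAC -natrX -natrM mulrC -expnM -expnD -natrX -natrM.
congr (_ * p ^ _)%:R; lia.
Qed.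

Lemma char_sub_neq1 x y : x != y -> e x * e (- y) != 1.
Proof. by rewrite -eD -subr_eq0 => /eqP xy; apply/eqP => /e_inj. Qed.

Lemma chi_orthogonal j c c' : (j <= k)%N -> c != c' %[mod p ^ j] ->
  \sum_(b in pball j) chi c b * ((chi c' b)^*)%C = 0.
Proof.
move=> jk cc'; apply: (sum_char_eq0 (x_probe_pball jk)) => [b b'|].
  by rewrite !chiD rmorphM mulrACA.
rewrite !chi_x_probe // char_conj char_sub_neq1 // (@natr_Zq_eq_mod _ _ j) //; lia.
Qed.

(** If the product character is 1 at both test points, the pairs have equal sums and equal sums of
    squares mod [p ^ j], so transversality forces them to coincide. *)
Lemma chi_pair_orthogonal j c1 c2 d1 d2 : (j <= k)%N -> (0 < j)%N ->
  c1 = d1 %[mod p] -> c2 = d2 %[mod p] -> c1 != c2 %[mod p] ->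
  (c1 != d1 %[mod p ^ j]) || (c2 != d2 %[mod p ^ j]) ->
  \sum_(b in pball j) chi c1 b * chi c2 b * ((chi d1 b * chi d2 b)^*)%C = 0.
Proof.
move=> jk j0; have jl : (j + (2 * (i + k) - j) = 2 * (i + k))%N by lia.
move=> cd1 cd2 c12 neq.
pose psi b := chi c1 b * chi c2 b * ((chi d1 b * chi d2 b)^*)%C.
have psiD b b' : psi (b + b') = psi b * psi b'.
  by rewrite /psi !chiD !rmorphM /=; ring.
have [x1|] := eqVneq (psi (x_probe j)) 1; last exact: sum_char_eq0 (x_probe_pball jk) psiD.
have [t1|] := eqVneq (psi (t_probe j)) 1; last exact: sum_char_eq0 (t_probe_pball jk) psiD.
exfalso; move: neq; rewrite -negb_and => /negP; apply.
have modzE m n a : (m == n %[mod a])%N = (a%:Z %| m%:Z - n%:Z)%Z.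
  by rewrite -eqz_mod_dvd !modz_nat.
have s1 : ((p ^ j)%N %| c1%:Z + c2%:Z - (d1%:Z + d2%:Z))%Z.
  rewrite -!PoszD -modzE -(natr_Zq_eq_mod _ _ jl).
  apply: contraPT x1 => /char_sub_neq1.
  by rewrite /psi !chi_x_probe // -!eD char_conj -eD -!natrD -!mulnDl => /eqP.
have s2 : ((p ^ j)%N %| c1%:Z ^+ 2 + c2%:Z ^+ 2 - (d1%:Z ^+ 2 + d2%:Z ^+ 2))%Z.
  have -> : c1%:Z ^+ 2 + c2%:Z ^+ 2 - (d1%:Z ^+ 2 + d2%:Z ^+ 2) =
      (c1 ^ 2 + c2 ^ 2)%N%:Z - (d1 ^ 2 + d2 ^ 2)%N%:Z by rewrite !PoszD -!mulnn !PoszM -!expr2.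
  rewrite -modzE -(natr_Zq_eq_mod _ _ jl).
  apply: contraPT t1 => /char_sub_neq1.
  by rewrite /psi !chi_t_probe // -!eD char_conj -eD -!natrD -!mulnDl => /eqP.
have z1 : (p %| c1%:Z - d1%:Z)%Z by rewrite -modzE; apply/eqP.
have z2 : (p %| c2%:Z - d2%:Z)%Z by rewrite -modzE; apply/eqP.
have z12 : ~~ (p %| c1%:Z - c2%:Z)%Z by rewrite -modzE.
rewrite !modzE (dvdz_quadratic_system p_prime p_odd z1 z2 z12 s1 s2) /=.
apply: (dvdz_quadratic_system p_prime p_odd z2 z1 _).
- by rewrite -modzE eq_sym.
- by rewrite (addrC c2%:Z) (addrC d2%:Z).
- by rewrite (addrC (c2%:Z ^+ 2)) (addrC (d2%:Z ^+ 2)).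
Qed.

(* The tiles of two distinct classes mod [p ^ j] together generate the next ball; this
   is where the curvature of the parabola enters. *)
Lemma pball_decomposition j c c' (b : G) : (0 < j)%N -> (j <= k)%N ->
  (c < p ^ j)%N -> (c' < p ^ j)%N -> c != c' -> b \in pball j.+1 ->
  exists2 h : G, tile j c h & tile j c' (b - h).
Proof.
move=> j_gt0 jk; wlog cc' : c c' b / (c < c')%N => [th cj c'j neq bB|].
  case: (ltngtP c c') neq => // [lt|lt] neq; first by apply: th => //; rewrite ltn_eqF.
  have [||||h h1 h2] := th c' c b lt => //; first by rewrite ltn_eqF.
  by exists (b - h) => //; rewrite opprB addrC subrK.
move=> cj c'j neq.
rewrite inE PS => /andP[/eqP b1 /eqP b2].
pose d := (c' - c)%N.
have d_gt0 : (0 < d)%N by rewrite subn_gt0.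
have vj : (logn p d < j)%N.
  rewrite -(ltn_exp2l _ _ (prime_gt1 p_prime)).
  by apply: leq_ltn_trans (dvdn_leq d_gt0 (pfactor_dvdnn _ _)) _; rewrite /d; lia.
(* With [h.2 = t] and [h.1] as below, [b - h] satisfies its first tile equation identically, and
   that of [h] becomes [2 * d * p ^ (j + 2 * i) * t = y]. It is solvable: [b] in the ball of scale
   [j.+1] gives [p * y = 0], and [0 < d < p ^ j] bounds the valuation of [d]. *)
pose y := P j * D * (b.1 + 2 * c'%:R * D * b.2).
have py : (p * val y)%:R = 0 :> Z.
  rewrite natrM natr_Zp.
  transitivity (p%:R * P j * D * b.1 + 2 * c'%:R * (p%:R * P j * D ^+ 2 * b.2)).
    by rewrite /y; ring.
  by rewrite b1 b2 mulr0 addr0.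
have aM : (logn p d + (j + 2 * i) < 2 * (i + k))%N by lia.
have [s sE] := linear_solution q_gt1 p_prime p_odd qE d_gt0 aM py.
set t := (p ^ _ * s)%N in sE; rewrite natr_Zp in sE.
(* The explicit power of [p] in [t] suffices here because [logn p d <= j - 1]. *)
have t2 : (P j * D) ^+ 2 * t%:R = 0.
  rewrite /t /P /D -!natrM -natrX -natrM -expnD -expnM mulnA -expnD natrM.
  by rewrite (natr_Zq_eq0_pow q_gt1 qE) ?mul0r//; lia.
have D2 : (p ^ (j + 2 * i))%:R = P j * D ^+ 2.
  by rewrite expnD natrM (mulnC 2 i) expnM [X in _ * X]natrX.
have dE : d%:R = c'%:R - c%:R :> Z by rewrite natrB // ltnW.
exists (b.1 + 2 * c'%:R * D * (b.2 - t%:R), t%:R); apply/andP; split; apply/eqP => //=.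
- transitivity (y - 2 * (c'%:R - c%:R) * (P j * D ^+ 2) * t%:R).
    by rewrite /y; ring.
  by rewrite -dE -sE 3!natrM D2; ring.
- by rewrite [X in X = 0](_ : _ = 0)//; ring.
- have Pj : P j = p%:R * P j.-1 by rewrite -PS prednK.
  have b2' : P j * (P j * D ^+ 2 * b.2) = 0.
    rewrite {1}Pj; transitivity (P j.-1 * (p%:R * P j * D ^+ 2 * b.2)); first by ring.
    by rewrite b2 mulr0.
  transitivity (P j * (P j * D ^+ 2 * b.2) - (P j * D) ^+ 2 * t%:R); first by ring.
  by rewrite b2' t2 subrr.
Qed.

(** * Pruned packets *)

Variables (a : nat -> R[i]) (lam : R).

(* [pruned n j c] is the packet of the class [c] mod [p ^ j], built from the single
   frequencies at scale [j + n] by discarding amplitudes above [lam] at each scale. *)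
Fixpoint pruned (n j c : nat) (y : G) : R[i] :=
  if n is m.+1 then
    let s := \sum_(d < p) pruned m j.+1 (c + p ^ j * d) y in
    if normc s <= lam then s else 0
  else a c * chi c y.

Definition packet (j : nat) := pruned (k - j) j.

(** The packet before the cut at its own scale; its children are already pruned. *)
Definition raw_packet (j c : nat) (y : G) : R[i] :=
  \sum_(d < p) packet j.+1 (c + p ^ j * d) y.

Lemma packetS j c y : (j < k)%N ->
  packet j c y = if normc (raw_packet j c y) <= lam then raw_packet j c y else 0.
Proof. by move=> jk; rewrite /packet -subnSK. Qed.

Lemma packet_leaf c y : packet k c y = a c * chi c y.
Proof. by rewrite /packet subnn. Qed.

(** On the tile all children transform by the same character [chi c], and the cut depends only on
    the modulus, so pruning preserves covariance. *)
Lemma pruned_tile n j c y h : tile j c h ->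
  pruned n j c (y + h) = chi c h * pruned n j c y.
Proof.
elim: n j c => [|n IH] j c hT /=; first by rewrite chiD; ring.
have -> : \sum_(d < p) pruned n j.+1 (c + p ^ j * d) (y + h) =
    chi c h * \sum_(d < p) pruned n j.+1 (c + p ^ j * d) y.
  rewrite mulr_sumr; apply: eq_bigr => d _.
  by rewrite IH ?tile_child // chi_tile.
rewrite normcM chi_norm mul1r; case: ifP => // _; by rewrite mulr0.
Qed.

Lemma packet_tile j c y h : tile j c h ->
  packet j c (y + h) = chi c h * packet j c y.
Proof. exact: pruned_tile. Qed.

Lemma normc_packet_tile j c y h : tile j c h ->
  normc (packet j c (y + h)) = normc (packet j c y).
Proof. by move=> hT; rewrite packet_tile // normcM chi_norm mul1r. Qed.

Hypothesis lam_ge0 : 0 <= lam.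

Lemma packet_le_lam j c y : (j < k)%N -> normc (packet j c y) <= lam.
Proof. by move=> jk; rewrite packetS //; case: ifP => // _; rewrite normc0. Qed.

Lemma packet_le_raw_packet j c y : (j < k)%N -> normc (packet j c y) <= normc (raw_packet j c y).
Proof. by move=> jk; rewrite packetS //; case: ifP => // _; rewrite normc0 normc_ge0. Qed.

(** * Averages over balls and the energies of successive scales *)

Definition avg (j : nat) (F : G -> R) (y : G) : R :=
  #|pball j|%:R^-1 * \sum_(b in pball j) F (y + b).

Lemma card_pball_neq0 j : #|pball j|%:R != 0 :> R.
Proof. by rewrite pnatr_eq0 -lt0n card_pball_gt0. Qed.

Lemma sum_avg j F : \sum_y avg j F y = \sum_y F y.
Proof.
rewrite -mulr_sumr exchange_big /=.
under eq_bigr => b _ do rewrite (sum_shiftT F).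
by rewrite sumr_const -[X in _ * X]mulr_natl mulrA mulVf ?mul1r // card_pball_neq0.
Qed.

Lemma avg_pball j F y b : b \in pball j -> avg j F (y + b) = avg j F y.
Proof.
move=> bB; congr (_ * _); rewrite -(sum_shift (fun b' => F (y + b')) (pball_shift bB)).
by apply: eq_bigr => b' _; rewrite addrAC -addrA.
Qed.

Lemma le_avg j (F F' : G -> R) y : (forall y, F y <= F' y) -> avg j F y <= avg j F' y.
Proof.
by move=> FF'; rewrite ler_wpM2l ?invr_ge0 // ler_sum.
Qed.

Lemma avg_cst j (F : G -> R) y : (forall b, b \in pball j -> F (y + b) = F y) -> avg j F y = F y.
Proof.
move=> Fb; rewrite /avg (eq_bigr _ (fun b bB => Fb b bB)) sumr_const -[X in _ * X]mulr_natl.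
by rewrite mulrA mulVf ?mul1r // card_pball_neq0.
Qed.

Lemma avg_sum j (I : Type) (r : seq I) (S : pred I) (F : I -> G -> R) y :
  avg j (fun y => \sum_(c <- r | S c) F c y) y = \sum_(c <- r | S c) avg j (F c) y.
Proof. by rewrite /avg exchange_big mulr_sumr. Qed.

(* Distinct children of a class have orthogonal wave packets on every ball of the
   next scale, where each of them has constant modulus. *)
Lemma avg_raw_packet j c y : (j < k)%N -> (c < p ^ j)%N ->
  avg j.+1 (fun y => normc (raw_packet j c y) ^+ 2) y =
  \sum_(d < p) normc (packet j.+1 (c + p ^ j * d) y) ^+ 2.
Proof.
move=> jk cj; pose I : finType := 'I_p.
pose psi (d : I) (b : G) := chi (c + p ^ j * d) b.
pose w (d : I) := packet j.+1 (c + p ^ j * d) y.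
rewrite /avg; have -> : \sum_(b in pball j.+1) normc (raw_packet j c (y + b)) ^+ 2 =
    \sum_(b in pball j.+1) normc (\sum_(d | xpredT d) w d * psi d b) ^+ 2.
  apply: eq_bigr => b bB; congr (normc _ ^+ 2); apply: eq_bigr => d _.
  by rewrite packet_tile 1?mulrC // pball_tile.
rewrite orthogonal_sum_sqr.
- by rewrite mulrA mulVf ?mul1r // card_pball_neq0.
- by move=> d b _; exact: chi_norm.
move=> d d' _ _ dd'; apply: chi_orthogonal => //.
have lt x : (x < p -> c + p ^ j * x < p ^ j.+1)%N.
  move=> xp; apply: (@leq_trans (p ^ j * x.+1)%N); first by rewrite mulnS ltn_add2r.
  by rewrite expnSr leq_pmul2l // expn_gt0 prime_gt0.
rewrite !modn_small ?lt // eqn_add2l eqn_pmul2l // expn_gt0 prime_gt0 //.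
Qed.

Definition energy (j : nat) (y : G) : R := \sum_(c < p ^ j) normc (packet j c y) ^+ 2.
Definition raw_energy (j : nat) (y : G) : R := \sum_(c < p ^ j) normc (raw_packet j c y) ^+ 2.
Let A : R := \sum_(c < p ^ k) normc (a c) ^+ 2.

Lemma energy_ge0 j y : 0 <= energy j y.
Proof. exact: sum_sqr_ge0. Qed.

Lemma energy_leaf y : energy k y = A.
Proof. by apply: eq_bigr => c _; rewrite packet_leaf normcM chi_norm mulr1. Qed.

Lemma energyS j y : energy j.+1 y =
  \sum_(c < p ^ j) \sum_(d < p) normc (packet j.+1 (c + p ^ j * d) y) ^+ 2.
Proof.
by rewrite /energy -(sum_digits _ _ (fun c => normc (packet j.+1 c y) ^+ 2)) -expnSr.
Qed.

Lemma avg_raw_energy j y : (j < k)%N -> avg j.+1 (raw_energy j) y = energy j.+1 y.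
Proof.
move=> jk; rewrite /raw_energy avg_sum energyS; apply: eq_bigr => c _.
exact: avg_raw_packet.
Qed.

Lemma energy_le_raw j y : (j < k)%N -> energy j y <= raw_energy j y.
Proof.
move=> jk; apply: ler_sum => c _.
by rewrite lerXn2r ?nnegrE ?normc_ge0 // packet_le_raw_packet.
Qed.

(** The reversed martingale identity holds for the raw energy; pruning at scale [j] can only
    decrease the left side. *)
Lemma avg_energy_le j y : (j < k)%N -> avg j.+1 (energy j) y <= energy j.+1 y.
Proof.
move=> jk; rewrite -avg_raw_energy //; apply: le_avg => z; exact: energy_le_raw.
Qed.

(** Without averaging, Cauchy-Schwarz over the [p] children costs a factor [p]. *)
Lemma raw_energy_le j y : raw_energy j y <= p%:R * energy j.+1 y.
Proof.
rewrite energyS mulr_sumr; apply: ler_sum => c _; exact: normc_sum_sqr_le.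
Qed.

Lemma sum_energy_le j : (j <= k)%N -> \sum_y energy j y <= A *+ #|{: G}|.
Proof.
move=> jk; have [n nE] : exists n, (n = k - j)%N by eexists.
elim: n j jk nE => [|n IH] j jk nE.
  have -> : j = k by lia.
  by under eq_bigr => y _ do rewrite energy_leaf; rewrite sumr_const.
apply: le_trans (IH j.+1 _ _); try lia.
rewrite -(sum_avg j.+1); apply: ler_sum => y _; apply: avg_energy_le; lia.
Qed.

Lemma energy_pball j y b : b \in pball j -> energy j (y + b) = energy j y.
Proof.
by move=> bB; apply: eq_bigr => c _; rewrite normc_packet_tile // pball_tile.
Qed.

(** * The high part and its orthogonality *)

Definition high_energy (j : nat) (y : G) : R := energy j y - avg j.+1 (energy j) y.

Let high_packet (j c : nat) (y : G) : R :=
  normc (packet j c y) ^+ 2 - avg j.+1 (fun y => normc (packet j c y) ^+ 2) y.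

Lemma high_packet_tile j c (y h : G) : tile j c h -> high_packet j c (y + h) = high_packet j c y.
Proof.
move=> hT; rewrite /high_packet /avg normc_packet_tile //; congr (_ - _ * _).
by apply: eq_bigr => b _; rewrite [y + h + b]addrAC (normc_packet_tile (y + b) hT).
Qed.

Lemma sum_pball_high_packet j c (y : G) : \sum_(b in pball j.+1) high_packet j c (y + b) = 0.
Proof.
rewrite sumrB [X in _ - X](eq_bigr (fun=> avg j.+1 (fun y => normc (packet j c y) ^+ 2) y)).
  by rewrite sumr_const -[X in _ - X]mulr_natl mulrA divff ?mul1r ?subrr // card_pball_neq0.
by move=> b bB; exact: avg_pball.
Qed.

(* Averaging over [b = h + (b - h)] in a ball moves [h] onto the first factor and
   [b - h] onto the second, both of which are invariant; the average of the second
   factor over the ball vanishes. *)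
Lemma high_packet_orthogonal j c c' : (0 < j)%N -> (j < k)%N ->
  (c < p ^ j)%N -> (c' < p ^ j)%N -> c != c' ->
  \sum_y high_packet j c y * high_packet j c' y = 0.
Proof.
move=> j_gt0 jk cj c'j cc'; set S := LHS.
have shiftE b : b \in pball j.+1 ->
    \sum_y high_packet j c y * high_packet j c' (y + b) = S.
  move=> bB; have [h hc hc'] := pball_decomposition j_gt0 (ltnW jk) cj c'j cc' bB.
  rewrite /S -(sum_shiftT (fun y => high_packet j c y * high_packet j c' y) h).
  apply: eq_bigr => y _; rewrite (high_packet_tile y hc) -(high_packet_tile (y + h) hc').
  by rewrite -addrA [h + _]addrC subrK.
have : \sum_(b in pball j.+1) \sum_y high_packet j c y * high_packet j c' (y + b) = 0.
  rewrite exchange_big big1 // => y _.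
  by rewrite -mulr_sumr sum_pball_high_packet mulr0.
rewrite (eq_bigr _ shiftE) sumr_const -mulr_natl => /eqP.
by rewrite mulf_eq0 (negPf (card_pball_neq0 _)) => /eqP.
Qed.

(** Only the diagonal survives. There a packet's square [u] and its average [v] lie in
    [[0, lam ^+ 2]], so [(u - v) ^+ 2 <= lam ^+ 2 * (u + v)], and [u] and [v] have the same
    total. *)
Lemma sum_high_energy_sqr_le j : (0 < j)%N -> (j < k)%N ->
  \sum_y high_energy j y ^+ 2 <= 2 * lam ^+ 2 * (A *+ #|{: G}|).
Proof.
move=> j_gt0 jk.
have highE y : high_energy j y = \sum_(c < p ^ j) high_packet j c y.
  by rewrite /high_energy /energy avg_sum sumrB.
under eq_bigr => y _ do rewrite highE expr2 big_distrl /=.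
rewrite exchange_big /=.
have diagE (c : 'I_(p ^ j)) :
    \sum_y high_packet j c y * (\sum_(d < p ^ j) high_packet j d y) =
    \sum_y high_packet j c y ^+ 2.
  under eq_bigr => y _ do rewrite mulr_sumr.
  rewrite exchange_big (bigD1 c) //= [X in _ + X]big1 ?addr0 // => d dc.
  by apply: high_packet_orthogonal => //; rewrite eq_sym.
rewrite (eq_bigr _ (fun c _ => diagE c)).
have le_part c y : high_packet j c y ^+ 2 <=
    lam ^+ 2 * (normc (packet j c y) ^+ 2 + avg j.+1 (fun y => normc (packet j c y) ^+ 2) y).
  rewrite /high_packet; set u := normc _ ^+ 2; set v := avg _ _ _.
  have u0 : 0 <= u by exact: sqr_ge0.
  have le_lam z : normc (packet j c z) ^+ 2 <= lam ^+ 2.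
    by rewrite lerXn2r ?nnegrE ?normc_ge0 ?packet_le_lam.
  have u1 : u <= lam ^+ 2 by exact: le_lam.
  have v0 : 0 <= v.
    by rewrite mulr_ge0 ?invr_ge0 // sumr_ge0 // => b _; exact: sqr_ge0.
  have v1 : v <= lam ^+ 2.
    by rewrite -(@avg_cst j.+1 (fun=> lam ^+ 2) y) //; apply: le_avg.
  have -> : (u - v) ^+ 2 = u * (u - v) + v * (v - u) by ring.
  by rewrite [leRHS]mulrDr lerD // mulrC ler_wpM2r //; lra.
apply: le_trans (_ : \sum_(c < p ^ j) \sum_y lam ^+ 2 * (normc (packet j c y) ^+ 2 +
   avg j.+1 (fun y => normc (packet j c y) ^+ 2) y) <= _).
  by apply: ler_sum => c _; apply: ler_sum => y _; exact: le_part.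
under eq_bigr => c _ do rewrite -mulr_sumr big_split /= sum_avg.
rewrite -mulr_sumr big_split /= exchange_big; set T := \sum_y _.
have -> : lam ^+ 2 * (T + T) = 2 * lam ^+ 2 * T by ring.
by apply: ler_wpM2l (sum_energy_le (ltnW jk)); rewrite mulr_ge0 ?sqr_ge0.
Qed.

(** * The transversal bilinear estimate and the cost of pruning *)

Definition coarse_sum (j t : nat) (y : G) : R[i] :=
  \sum_(c < p ^ j | (c %% p == t)%N) packet j c y.

(* Transversality: on a ball of scale [j] the products of wave packets from two
   different classes mod [p] are pairwise orthogonal. *)
Lemma bilinear_pball_le j t1 t2 y : (0 < j)%N -> (j <= k)%N -> t1 != t2 ->
  \sum_(b in pball j) (normc (coarse_sum j t1 (y + b)) * normc (coarse_sum j t2 (y + b))) ^+ 2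
   <= #|pball j|%:R * energy j y ^+ 2.
Proof.
move=> j_gt0 jk t12; pose I : finType := ('I_(p ^ j) * 'I_(p ^ j))%type.
pose S (c : I) := (c.1 %% p == t1)%N && (c.2 %% p == t2)%N.
pose psi (c : I) (b : G) := chi c.1 b * chi c.2 b.
pose w (c : I) := packet j c.1 y * packet j c.2 y.
have -> : \sum_(b in pball j) (normc (coarse_sum j t1 (y + b)) * normc (coarse_sum j t2 (y + b))) ^+ 2
    = \sum_(b in pball j) normc (\sum_(c | S c) w c * psi c b) ^+ 2.
  apply: eq_bigr => b bB; rewrite -normcM; congr (normc _ ^+ 2).
  rewrite /coarse_sum big_distrlr pair_big /=; apply: eq_bigr => c _.
  by rewrite !packet_tile ?pball_tile // /w /psi; ring.
rewrite orthogonal_sum_sqr.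
- apply: ler_wpM2l => //.
  under eq_bigr => c _ do rewrite normcM exprMn.
  rewrite -(pair_big (fun c : 'I_(p ^ j) => c %% p == t1)%N (fun c : 'I_(p ^ j) => c %% p == t2)%N
    (fun c d : 'I_(p ^ j) => normc (packet j c y) ^+ 2 * normc (packet j d y) ^+ 2)) /=.
  rewrite -big_distrlr /= expr2.
  have le_energy t : \sum_(c < p ^ j | (c %% p == t)%N) normc (packet j c y) ^+ 2 <= energy j y.
    rewrite /energy [X in _ <= X](bigID (fun c : 'I_(p ^ j) => c %% p == t)%N) /=.
    by rewrite lerDl sum_sqr_ge0.
  by rewrite ler_pM ?sum_sqr_ge0.
- by move=> c b _; rewrite normcM !chi_norm mulr1.
move=> [c1 c2] [d1 d2] /andP[/= /eqP c1t /eqP c2t] /andP[/= /eqP d1t /eqP d2t] neq.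
apply: chi_pair_orthogonal => //=.
- by rewrite c1t d1t.
- by rewrite c2t d2t.
- by rewrite c1t c2t.
by rewrite !modn_small // -negb_and.
Qed.

Lemma coarse_sumS j t y : (0 < j)%N ->
  coarse_sum j.+1 t y = \sum_(c < p ^ j | (c %% p == t)%N) raw_packet j c y.
Proof.
move=> j_gt0; rewrite /coarse_sum big_mkcond expnSr.
rewrite (sum_digits _ _ (fun c => if (c %% p == t)%N then packet j.+1 c y else 0)).
(* As [j > 0], children keep the residue mod [p] of their parent. *)
have modE c d : ((c + p ^ j * d) %% p = c %% p)%N.
  by rewrite -(prednK j_gt0) expnS -mulnA mulnC addnC modnMDl.
rewrite [RHS]big_mkcond; apply: eq_bigr => c _.
by under eq_bigr => d _ do rewrite modE; case: ifP => // _; rewrite big1.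
Qed.

(** Telescope over scales: a discarded packet [s] exceeds [lam], so its modulus is at most
    [normc s ^+ 2 / lam], and these squares sum to at most the raw energy. *)
Lemma pruning_error j t y (E0 : R) : (0 < j)%N -> (j <= k)%N -> 0 < lam ->
  (forall l, (j < l <= k)%N -> energy l y <= E0) ->
  normc (coarse_sum k t y - coarse_sum j t y) <= (k - j)%:R * (p%:R * E0 / lam).
Proof.
move=> + + lam_gt0; move: {2}(k - j)%N (erefl (k - j)%N) => n.
elim: n j => [|n IH] j nE j_gt0 jk E0P.
  have -> : j = k by lia.
  by rewrite subrr normc0 subnn mul0r.
have -> : coarse_sum k t y - coarse_sum j t y =
    (coarse_sum k t y - coarse_sum j.+1 t y) + (coarse_sum j.+1 t y - coarse_sum j t y) by ring.
apply: le_trans (le_normcD _ _) _.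
have -> : (k - j = (k - j.+1) + 1)%N by lia.
rewrite natrD mulrDl mul1r; apply: lerD.
  by apply: IH; rewrite ?ltnS //; [lia|lia|move=> l lP; apply: E0P; lia].
rewrite coarse_sumS // /coarse_sum -sumrB; apply: le_trans (le_normc_sum _ _ _) _.
rewrite ler_pdivlMr // mulr_suml.
apply: (@le_trans _ _ (raw_energy j y)); last first.
  by apply: le_trans (raw_energy_le j y) _; rewrite ler_wpM2l // E0P //; lia.
rewrite big_mkcond; apply: ler_sum => c _; case: ifP => _; last exact: sqr_ge0.
rewrite packetS; last by lia.
case: ifPn => [_|]; first by rewrite subrr normc0 mul0r sqr_ge0.
by rewrite -ltNge subr0 => /ltW lamr; rewrite expr2 ler_wpM2l ?normc_ge0.
Qed.

(** * Splitting points by their last loud scale *)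

(* [last_loud j y]: [j] is the last scale at which the high part is large at [y]. *)
Let quiet (j : nat) (y : G) : bool :=
  [forall l : 'I_k, (j < l)%N ==> (high_energy l y <= A / k%:R)].
Let last_loud (j : nat) (y : G) : bool := (A / k%:R < high_energy j y) && quiet j y.

Let A_ge0 : 0 <= A. Proof. exact: sum_sqr_ge0. Qed.

Lemma quietP j y : reflect (forall l, (j < l < k)%N -> high_energy l y <= A / k%:R) (quiet j y).
Proof.
apply: (iffP forallP) => [H l /andP[jl lk]|H l]; first exact: (implyP (H (Ordinal lk))).
by apply/implyP => jl; apply: H; rewrite jl /=.
Qed.

(** Descending from the leaves, where the energy is [A], each quiet scale adds at most [A / k] and
    there are at most [k] of them. *)
Lemma energy_quiet j l y : quiet j y -> (j < l <= k)%N -> energy l y <= 2 * A.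
Proof.
move=> /quietP qy /andP[jl lk].
have k_gt0 : 0 < k%:R :> R by rewrite ltr0n; lia.
suff H n : (n = k - l)%N -> energy l y <= A + n%:R * (A / k%:R).
  apply: le_trans (H _ erefl) _; rewrite mulr2n mulrDl mul1r lerD2l mulrCA.
  by rewrite -[leRHS]mulr1 ler_wpM2l // ler_pdivrMr // mul1r ler_nat leq_subr.
elim: n l jl lk => [|n IH] l jl lk nE.
  by have -> : l = k by [lia]; rewrite energy_leaf mul0r addr0.
have lk' : (l < k)%N by lia.
have h1 : high_energy l y <= A / k%:R by apply: qy; rewrite jl.
have h2 := avg_energy_le y lk'.
have nE' : n = (k - l.+1)%N by lia.
have h3 : energy l.+1 y <= A + n%:R * (A / k%:R) := IH _ (leqW jl) lk' nE'.
rewrite /high_energy in h1; rewrite -natr1 mulrDl mul1r; lra.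
Qed.

Lemma quiet_or_last_loud y : quiet 0 y \/ exists j : 'I_k, (0 < j)%N && last_loud j y.
Proof.
suff H n j : (n = k - j)%N -> quiet j y \/ exists l : 'I_k, (j < l)%N && last_loud l y.
  exact: (H _ _ erefl).
elim: n j => [|n IH] j nE; first by left; apply/quietP => l ?; lia.
case: (IH j.+1) => [|qy|[l /andP[jl ly]]]; first lia.
  have [jk|jk] := ltnP j.+1 k; last first.
    by left; apply/quietP => l ?; lia.
  have [loud|soft] := ltP (A / k%:R) (high_energy j.+1 y).
    by right; exists (Ordinal jk); rewrite /last_loud /= loud qy ltnSn.
  left; apply/quietP => l /andP[jl lk]; case: (ltngtP l j.+1) => [|jl'|->] //; first by lia.
  by apply: (quietP _ _ qy); rewrite jl'.
by right; exists l; rewrite ly andbT; lia.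
Qed.

Lemma high_energy_pball j l (y b : G) : (j <= l)%N -> b \in pball j -> high_energy l (y + b) = high_energy l y.
Proof.
move=> jl bB; rewrite /high_energy energy_pball ?(pball_le jl) // avg_pball //.
by rewrite (@pball_le j) // leqW.
Qed.

Lemma last_loud_pball j (y b : G) : b \in pball j -> last_loud j (y + b) = last_loud j y.
Proof.
move=> bB; rewrite /last_loud (@high_energy_pball j) //; congr (_ && _).
apply: eq_forallb => l; case: ltnP => //= jl.
by rewrite (@high_energy_pball j) // ltnW.
Qed.

(** An invariant set is a union of cosets of the ball. Applied to the last loud set, this brings in
    the bilinear estimate on balls. *)
Lemma sum_pball_invariant j (S : {set G}) (F : G -> R) :
  (forall y b : G, b \in pball j -> (y + b \in S) = (y \in S)) ->
  \sum_(y in S) F y = \sum_(y in S) avg j F y.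
Proof.
move=> SB; rewrite -mulr_sumr exchange_big /=.
under [X in _ = _ * X]eq_bigr => b bB do rewrite (sum_shift F (fun y => SB y b bB)).
by rewrite sumr_const -[X in _ * X]mulr_natl mulrA mulVf ?mul1r // card_pball_neq0.
Qed.

(** * The weak-type bound for two transversal parts *)

Variable beta : R.
Hypotheses (beta_gt0 : 0 < beta) (A_gt0 : 0 < A) (k_gt0 : (0 < k)%N).
(** Chosen so that [k] scales of pruning, each costing [p * (2 * A) / lam], change a sum by at most
    [beta / 2]. *)
Hypothesis lamE : lam = 4 * p%:R * k%:R * A / beta.

Let pR_gt0 : 0 < p%:R :> R. Proof. by rewrite ltr0n prime_gt0. Qed.
Let kR_gt0 : 0 < k%:R :> R. Proof. by rewrite ltr0n. Qed.

Lemma coarse_sum_ge j t y : (0 < j)%N -> (j <= k)%N ->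
  (forall l, (j < l <= k)%N -> energy l y <= 2 * A) ->
  beta <= normc (coarse_sum k t y) -> beta / 2 <= normc (coarse_sum j t y).
Proof.
move=> j_gt0 jk El bt.
have lam_gt0 : 0 < lam by rewrite lamE divr_gt0 // !mulr_gt0.
have err := pruning_error t j_gt0 jk lam_gt0 El.
have le_err : (k - j)%:R * (p%:R * (2 * A) / lam) <= beta / 2.
  have -> : beta / 2 = k%:R * (p%:R * (2 * A) / lam).
    by rewrite lamE; field; rewrite !lt0r_neq0.
  apply: ler_wpM2r; last by rewrite ler_nat leq_subr.
  by rewrite divr_ge0 ?mulr_ge0 // ltW.
have := le_normcD (coarse_sum j t y) (coarse_sum k t y - coarse_sum j t y).
rewrite addrC subrK; lra.
Qed.

Variables t1 t2 : nat.
Hypotheses (t12 : t1 != t2) (t1p : (t1 < p)%N).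

Let U : {set G} := [set y | (beta <= normc (coarse_sum k t1 y)) && (beta <= normc (coarse_sum k t2 y))].

Lemma normc_coarse_sum1_sqr_le y : normc (coarse_sum 1 t1 y) ^+ 2 <= energy 1 y.
Proof.
have t1p1 : (t1 < p ^ 1)%N by rewrite expn1.
rewrite /coarse_sum /energy (bigD1 (Ordinal t1p1)) /=; last by rewrite modn_small ?expn1.
rewrite big1 ?addr0 => [|c /andP[/eqP ct /eqP cne]].
  by rewrite (bigD1 (Ordinal t1p1)) //= lerDl sum_sqr_ge0.
by case: cne; apply: val_inj; rewrite /= -ct modn_small // -[X in (_ < X)%N](expn1 p).
Qed.

(** At scale 1 a coarse sum is a single packet, so [beta ^+ 2 <= 4 * energy 1 y <= 8 * A]. Two
    factors [beta ^+ 2] are bounded by [8 * A] and the third by the energy, which is then summed. *)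
Lemma weak_quiet_le :
  beta ^+ 6 * #|[set y in U | quiet 0 y]|%:R <= 256 * A ^+ 2 * (A *+ #|{: G}|).
Proof.
apply: le_trans (_ : 256 * A ^+ 2 * (\sum_y energy 1 y) <= _); last first.
  by rewrite ler_wpM2l ?sum_energy_le // mulr_ge0 ?sqr_ge0.
rewrite mulr_natr -sumr_const mulr_sumr big_mkcond /=; apply: ler_sum => y _.
case: ifP => [|_]; last by rewrite !mulr_ge0 ?sqr_ge0 ?energy_ge0.
rewrite !inE => /andP[/andP[b1 b2] qy].
have e2 : energy 1 y <= 2 * A by apply: (energy_quiet qy).
have bc : beta / 2 <= normc (coarse_sum 1 t1 y).
  apply: (coarse_sum_ge (isT : (0 < 1)%N) k_gt0 _ b1) => l /andP[l1 lk].
  by apply: (energy_quiet qy); rewrite lk (ltnW l1).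
have be : beta ^+ 2 <= 4 * energy 1 y.
  have : (beta / 2) ^+ 2 <= energy 1 y.
    apply: le_trans (normc_coarse_sum1_sqr_le y).
    by rewrite lerXn2r ?nnegrE ?normc_ge0 // divr_ge0 // ltW.
  by rewrite expr_div_n => ?; lra.
have b8 : beta ^+ 2 <= 8 * A by lra.
have b4 : beta ^+ 4 <= 64 * A ^+ 2.
  rewrite -[X in beta ^+ X]/(2 * 2)%N exprM (_ : 64 * _ = (8 * A) ^+ 2); last by ring.
  by rewrite lerXn2r ?nnegrE ?sqr_ge0 ?mulr_ge0.
rewrite (_ : 256 * A ^+ 2 * _ = (64 * A ^+ 2) * (4 * energy 1 y)); last by ring.
by rewrite -[X in beta ^+ X]/(4 + 2)%N exprD ler_pM ?exprn_ge0 // ltW.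
Qed.

(** Chebyshev's inequality for the second moment of the high part. *)
Lemma card_last_loud_le j : (0 < j)%N -> (j < k)%N ->
  (A / k%:R) ^+ 2 * #|[set y | last_loud j y]|%:R <= 2 * lam ^+ 2 * (A *+ #|{: G}|).
Proof.
move=> j_gt0 jk; apply: le_trans (sum_high_energy_sqr_le j_gt0 jk).
rewrite mulr_natr -sumr_const big_mkcond /=; apply: ler_sum => y _.
case: ifP => [|_]; last exact: sqr_ge0.
rewrite inE => /andP[/ltW h _]; rewrite lerXn2r ?nnegrE //.
  by rewrite divr_ge0.
by apply: le_trans h; rewrite divr_ge0.
Qed.

Lemma weak_last_loud_le j : (0 < j)%N -> (j < k)%N ->
  beta ^+ 6 * #|[set y in U | last_loud j y]|%:R <=
  2048 * p%:R ^+ 4 * k%:R ^+ 4 * A ^+ 2 * (A *+ #|{: G}|).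
Proof.
move=> j_gt0 jk; pose W := [set y : G | last_loud j y].
have WB y b : b \in pball j -> (y + b \in W) = (y \in W).
  by move=> bB; rewrite !inE last_loud_pball.
pose F y := (normc (coarse_sum j t1 y) * normc (coarse_sum j t2 y)) ^+ 2.
(* Beyond scale [j] everything is quiet, so both coarse sums of scale [j] still reach [beta / 2]. *)
have E1 : (beta / 2) ^+ 4 * #|[set y in U | last_loud j y]|%:R <= \sum_(y in W) F y.
  rewrite mulr_natr -sumr_const big_mkcond [leRHS]big_mkcond /=; apply: ler_sum => y _.
  rewrite !inE; case: (boolP (last_loud j y)) => [/andP[_ qy]|_]; last by rewrite andbF.
  have El l : (j < l <= k)%N -> energy l y <= 2 * A by exact: energy_quiet.
  rewrite andbT; case: ifP => [/andP[b1 b2]|_] /=; last exact: sqr_ge0.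
  have c1 := coarse_sum_ge j_gt0 (ltnW jk) El b1.
  have c2 := coarse_sum_ge j_gt0 (ltnW jk) El b2.
  have b0 : 0 <= beta / 2 by rewrite divr_ge0 ?ltW.
  rewrite -[X in _ ^+ X <= _]/(2 * 2)%N exprM lerXn2r ?nnegrE ?sqr_ge0 ?mulr_ge0 ?normc_ge0 //.
  by rewrite expr2 ler_pM.
have E2 : \sum_(y in W) F y <= (2 * p%:R * A) ^+ 2 * #|W|%:R.
  rewrite (sum_pball_invariant _ WB) mulr_natr -sumr_const; apply: ler_sum => y.
  rewrite inE => /andP[_ qy].
  (* Scale [j] itself is loud, so the bound is borrowed from scale [j.+1] at the price of a factor
     [p]. *)
  have ej : energy j y <= 2 * p%:R * A.
    apply: le_trans (energy_le_raw y jk) _; apply: le_trans (raw_energy_le j y) _.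
    rewrite -mulrA mulrCA; apply: ler_wpM2l; first exact: ltW.
    by apply: (energy_quiet qy); rewrite ltnSn.
  apply: le_trans (_ : energy j y ^+ 2 <= _).
    rewrite /avg ler_pdivrMl ?ltr0n ?card_pball_gt0 //.
    exact: bilinear_pball_le (ltnW jk) t12.
  by rewrite lerXn2r ?nnegrE ?energy_ge0 // !mulr_ge0 // ltW.
have E3 := card_last_loud_le j_gt0 jk.
have E12 := le_trans E1 E2.
set u := #|[set y in U | _]|%:R in E12 *; set w := #|W|%:R in E12 E3.
set T := A *+ _ in E3 *.
have E4 : beta ^+ 4 * u <= 128 * p%:R ^+ 2 * k%:R ^+ 2 * lam ^+ 2 * T.
  have -> : beta ^+ 4 * u = 16 * ((beta / 2) ^+ 4 * u) by field.
  apply: le_trans (_ : 16 * ((2 * p%:R * A) ^+ 2 * w) <= _); first by rewrite ler_pM2l.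
  have -> : 16 * ((2 * p%:R * A) ^+ 2 * w) =
      64 * p%:R ^+ 2 * k%:R ^+ 2 * ((A / k%:R) ^+ 2 * w) by field; rewrite lt0r_neq0.
  apply: le_trans (ler_wpM2l _ E3) _; first by rewrite !mulr_ge0 ?sqr_ge0.
  by rewrite le_eqVlt; apply/orP; left; apply/eqP; ring.
have -> : beta ^+ 6 * u = beta ^+ 2 * (beta ^+ 4 * u) by ring.
apply: le_trans (ler_wpM2l (sqr_ge0 _) E4) _; rewrite le_eqVlt; apply/orP; left; apply/eqP.
by rewrite lamE; field; rewrite lt0r_neq0.
Qed.

(** Every point is quiet from the start or has one of fewer than [k] last loud scales; the union
    bound turns [k ^ 4] into [k ^ 5]. *)
Lemma weak_type : beta ^+ 6 * #|U|%:R <=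
  (256 + 2048 * p%:R ^+ 4 * k%:R ^+ 5) * A ^+ 2 * (A *+ #|{: G}|).
Proof.
have Usub : (#|U| <= #|[set y in U | quiet 0 y]| +
    \sum_(j < k | (0 < j)%N) #|[set y in U | last_loud j y]|)%N.
  rewrite -!sum1_card big_mkcond /= [X in (_ <= X + _)%N]big_mkcond /=.
  under [X in (_ <= _ + X)%N]eq_bigr => j _ do rewrite -sum1_card big_mkcond /=.
  rewrite exchange_big -big_split /=; apply: leq_sum => y _; case: ifP => // yU.
  have UE (S : pred G) : (y \in [set y in U | S y]) = S y by rewrite inE yU.
  case: (quiet_or_last_loud y) => [qy|[j /andP[j_gt0 ly]]].
    by rewrite (UE (quiet 0)) qy.
  by rewrite [X in (_ <= _ + X)%N](bigD1 j) //= (UE (last_loud j)) ly addnCA leq_addr.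
set T := A *+ _; have T_ge0 : 0 <= A ^+ 2 * T by rewrite mulr_ge0 ?sqr_ge0 ?mulrn_wge0.
apply: le_trans (_ : beta ^+ 6 * (#|[set y in U | quiet 0 y]| +
    \sum_(j < k | (0 < j)%N) #|[set y in U | last_loud j y]|)%:R <= _).
  by apply: ler_wpM2l; rewrite ?exprn_ge0 ?ler_nat ?ltW.
rewrite natrD mulrDr natr_sum mulr_sumr -mulrA mulrDl; apply: lerD.
  by rewrite mulrA; exact: weak_quiet_le.
apply: le_trans (_ : \sum_(j < k) 2048 * p%:R ^+ 4 * k%:R ^+ 4 * A ^+ 2 * T <= _).
  rewrite big_mkcond; apply: ler_sum => j _; case: ifP => [j_gt0|_].
    exact: weak_last_loud_le.
  rewrite -mulrA; apply: mulr_ge0 T_ge0.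
  exact: mulr_ge0 (mulr_ge0 (ler0n _ _) (exprn_ge0 _ (ltW pR_gt0))) (exprn_ge0 _ (ltW kR_gt0)).
rewrite sumr_const card_ord -mulr_natr le_eqVlt; apply/orP; left; apply/eqP; ring.
Qed.

End Wavepackets.

(** * The sixth moment on the finite group *)

(** A geometric layer-cake bound, which converts weak-type bounds at [n] levels into a sixth
    moment. *)
Lemma pow6_le_levels (R : realFieldType) (b s m : R) (n : nat) :
  0 <= s -> 0 <= b -> 0 <= m -> m <= s * b ^+ n ->
  m ^+ 6 <= s ^+ 6 + \sum_(j < n) (s * b ^+ j.+1) ^+ 6 * (s * b ^+ j <= m)%R%:R.
Proof.
move=> s0 b0 m0; elim: n => [|n IH] mn.
  by rewrite big_ord0 addr0 lerXn2r ?nnegrE // -[s]mulr1.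
rewrite big_ord_recr /= addrA; have [le_m|lt_m] := lerP (s * b ^+ n) m.
  rewrite mulr1 -[leLHS]add0r lerD //.
    rewrite addr_ge0 ?exprn_ge0 // sumr_ge0 // => j _.
    by rewrite mulr_ge0 ?exprn_ge0 ?mulr_ge0 ?exprn_ge0.
  by rewrite lerXn2r ?nnegrE ?mulr_ge0 ?exprn_ge0.
by rewrite mulr0 addr0 IH // ltW.
Qed.

(* Either one summand carries almost the whole sum, or two summands are comparable
   to it. *)
Lemma broad_narrow (R : rcfType) (n : nat) (F : 'I_n -> R[i]) (L : R) : 0 < L ->
  normc (\sum_t F t) ^+ 6 <= (1 + L^-1) ^+ 6 * \sum_t normc (F t) ^+ 6
    + (n%:R ^+ 2 * L) ^+ 6 *
      \sum_t1 \sum_(t2 | t2 != t1) Num.min (normc (F t1)) (normc (F t2)) ^+ 6.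
Proof.
move=> L0; case: n F => [|n] F.
  by rewrite !big_ord0 normc0 !mulr0 addr0 expr0n.
pose u t := normc (F t).
have u0 t : 0 <= u t by exact: normc_ge0.
pose m t1 t2 := Num.min (u t1) (u t2).
have m0 t1 t2 : 0 <= m t1 t2 by rewrite le_min !u0.
have n0 : 0 < n.+1%:R :> R by rewrite ltr0n.
have [t1 _ t1max] := @arg_maxP _ _ _ ord0 xpredT u isT.
have sum_le : normc (\sum_t F t) <= u t1 + \sum_(t | t != t1) u t.
  by apply: le_trans (le_normc_sum _ _ _) _; rewrite (bigD1 t1).
(* Narrow case: the terms other than the largest add up to at most [u t1 / L]. *)
have [/forallP narrow|] := boolP [forall t, (t != t1) ==> (n.+1%:R * L * u t <= u t1)].
  rewrite -[leLHS]addr0 lerD //; last first.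
    rewrite mulr_ge0 ?exprn_ge0 ?mulr_ge0 ?exprn_ge0 ?(ltW n0) ?(ltW L0) //.
    by rewrite sumr_ge0 // => i _; rewrite sumr_ge0 // => j _; rewrite exprn_ge0 ?m0.
  rewrite [X in _ <= _ * X](bigD1 t1) //= mulrDr -[leLHS]addr0 lerD //; last first.
    rewrite mulr_ge0 ?exprn_ge0 ?addr_ge0 ?invr_ge0 ?(ltW L0) //.
    by rewrite sumr_ge0 // => i _; rewrite exprn_ge0 ?normc_ge0.
  rewrite -exprMn lerXn2r ?nnegrE ?mulr_ge0 ?addr_ge0 ?invr_ge0 ?(ltW L0) ?normc_ge0 //.
  apply: le_trans sum_le _; rewrite mulrDl mul1r lerD2l.
  apply: le_trans (_ : \sum_(t : 'I_n.+1) (n.+1%:R * L)^-1 * u t1 <= _).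
    rewrite big_mkcond; apply: ler_sum => t _; case: ifP => tt1.
      by rewrite ler_pdivlMl ?mulr_gt0 //; exact: (implyP (narrow t)).
    by rewrite mulr_ge0 ?invr_ge0 ?mulr_ge0 ?(ltW n0) ?(ltW L0).
  rewrite sumr_const card_ord -[leLHS]mulr_natl invfM !mulrA divff ?mul1r //.
  by rewrite lt0r_neq0.
(* Broad case: with [m] summands, the sum is at most [m * u t1], hence at most
   [m ^ 2 * L * u t2]. *)
rewrite negb_forall => /existsP[t2]; rewrite negb_imply -ltNge => /andP[t21 broad].
rewrite -[leLHS]add0r lerD //.
  rewrite mulr_ge0 ?exprn_ge0 ?addr_ge0 ?invr_ge0 ?(ltW L0) //.
  by rewrite sumr_ge0 // => i _; rewrite exprn_ge0 ?normc_ge0.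
apply: le_trans (_ : (n.+1%:R ^+ 2 * L) ^+ 6 * m t1 t2 ^+ 6 <= _); last first.
  rewrite ler_wpM2l ?exprn_ge0 ?mulr_ge0 ?exprn_ge0 ?(ltW n0) ?(ltW L0) //.
  rewrite (bigD1 t1) //= (bigD1 t2) //= -addrA lerDl addr_ge0 //.
    by rewrite sumr_ge0 // => j _; rewrite exprn_ge0 ?m0.
  by rewrite sumr_ge0 // => i _; rewrite sumr_ge0 // => j _; rewrite exprn_ge0 ?m0.
rewrite -exprMn lerXn2r ?nnegrE ?normc_ge0 ?mulr_ge0 ?exprn_ge0 ?m0 ?(ltW n0) ?(ltW L0) //.
have -> : m t1 t2 = u t2 by apply/min_idPr; exact: t1max.
apply: le_trans (le_normc_sum _ _ _) _.
apply: le_trans (_ : \sum_(t : 'I_n.+1) u t1 <= _).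
  by apply: ler_sum => t _; exact: t1max.
rewrite sumr_const card_ord -[leLHS]mulr_natl expr2 -!mulrA. rewrite ler_pM2l // mulrA.
exact: ltW.
Qed.

(** * Strong bilinear bound, parabolic rescaling and induction on scales *)

Section FiniteRestriction.
Variables (R : rcfType) (p q : nat).
Hypotheses (p_prime : prime p) (p_odd : odd p) (q_gt1 : (1 < q)%N).
Local Notation G := ('Z_q * 'Z_q)%type.
Variable e : 'Z_q -> R[i].
Hypothesis eD : forall x y, e (x + y) = e x * e y.
Hypothesis e_norm : forall x, normc (e x) = 1.
Hypothesis e_inj : forall x, e x = 1 -> x = 0.

Definition class_sum (i k : nat) (a : nat -> R[i]) (t : nat) (y : G) : R[i] :=
  \sum_(c < p ^ k | (c %% p == t)%N) a c * chi p i e c y.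

Definition l2_mass (k : nat) (a : nat -> R[i]) : R := \sum_(c < p ^ k) normc (a c) ^+ 2.

Lemma l2_mass_ge0 k a : 0 <= l2_mass k a.
Proof. exact: sum_sqr_ge0. Qed.

Lemma coarse_sum_leaf i k a lam t y : coarse_sum p i k e a lam k t y = class_sum i k a t y.
Proof. by apply: eq_bigr => c _; rewrite packet_leaf. Qed.

(** A crude bound, enough to make [k] levels of ratio [p] cover all values. *)
Lemma normc_class_sum_le i k a t y : normc (class_sum i k a t y) <= p%:R ^+ k * Num.sqrt (l2_mass k a).
Proof.
have p0 : 0 <= p%:R ^+ k :> R by rewrite exprn_ge0.
rewrite -(@ler_pXn2r _ 2) ?nnegrE ?normc_ge0 ?mulr_ge0 ?sqrtr_ge0 // exprMn sqr_sqrtr ?l2_mass_ge0 //.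
rewrite /class_sum big_mkcond; apply: le_trans (normc_sum_sqr_le _) _; rewrite natrX.
apply: le_trans (_ : p%:R ^+ k * l2_mass k a <= _).
  apply: ler_wpM2l => //; apply: ler_sum => c _; case: ifP => _.
    by rewrite normcM chi_norm // mulr1.
  by rewrite normc0 expr0n sqr_ge0.
rewrite ler_wpM2r ?l2_mass_ge0 // -[leLHS]expr1 ler_weXn2l //.
by rewrite -natrX ler1n expn_gt0 prime_gt0.
Qed.

(** The 1 accounts for values below the lowest level; each of the [k] levels costs the weak-type
    constant and [p ^+ 6] for its width. *)
Definition bilinear_const (k : nat) : R :=
  1 + k%:R * p%:R ^+ 6 * (256 + 2048 * p%:R ^+ 4 * k%:R ^+ 5).

Lemma bilinear_const_ge0 k : 0 <= bilinear_const k.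
Proof.
have pX n : 0 <= p%:R ^+ n :> R by rewrite exprn_ge0.
have kX n : 0 <= k%:R ^+ n :> R by rewrite exprn_ge0.
apply: addr_ge0 ler01 (mulr_ge0 (mulr_ge0 (ler0n _ _) (pX _)) _).
exact: addr_ge0 (ler0n _ _) (mulr_ge0 (mulr_ge0 (ler0n _ _) (pX _)) (kX _)).
Qed.

Lemma bilinear_le i k a t1 t2 : q = (p ^ (2 * (i + k)))%N ->
  t1 != t2 -> (t1 < p)%N ->
  \sum_y Num.min (normc (class_sum i k a t1 y)) (normc (class_sum i k a t2 y)) ^+ 6 <=
  bilinear_const k * l2_mass k a ^+ 3 * #|{: G}|%:R.
Proof.
move=> qE t12 t1p; set s := Num.sqrt (l2_mass k a).
have s_ge0 : 0 <= s by exact: sqrtr_ge0.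
have s2 : s ^+ 2 = l2_mass k a by rewrite sqr_sqrtr ?l2_mass_ge0.
pose m y := Num.min (normc (class_sum i k a t1 y)) (normc (class_sum i k a t2 y)).
have p0 : 0 < p%:R :> R by rewrite ltr0n prime_gt0.
have m_le y : m y <= s * p%:R ^+ k.
  by rewrite mulrC /m ge_min normc_class_sum_le.
have m_ge0 y : 0 <= m y by rewrite /m le_min !normc_ge0.
pose W : R := (256 + 2048 * p%:R ^+ 4 * k%:R ^+ 5) * l2_mass k a ^+ 3 * #|{: G}|%:R.
have weak j : (j < k)%N ->
    (s * p%:R ^+ j.+1) ^+ 6 * \sum_y (s * p%:R ^+ j <= m y)%R%:R <= p%:R ^+ 6 * W.
  move=> jk; rewrite [_ ^+ j.+1]exprSr mulrA exprMn [_ * p%:R ^+ 6]mulrC -mulrA.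
  apply: ler_wpM2l; first by rewrite exprn_ge0 // ltW.
  have [s0|s_neq0] := eqVneq s 0.
    by rewrite /W -s2 s0 mul0r -exprM !expr0n /= !(mul0r, mulr0).
  have s_gt0 : 0 < s by rewrite lt_def s_neq0.
  have A_gt0 : 0 < l2_mass k a by rewrite -s2 exprn_gt0.
  have k_gt0 : (0 < k)%N by exact: leq_ltn_trans jk.
  set beta := s * p%:R ^+ j.
  have beta_gt0 : 0 < beta by rewrite mulr_gt0 ?exprn_gt0.
  have lam_ge0 : 0 <= 4 * p%:R * k%:R * l2_mass k a / beta.
    by rewrite divr_ge0 ?(ltW beta_gt0) // !mulr_ge0 // ltW.
  have := weak_type p_prime p_odd q_gt1 qE eD e_norm e_inj lam_ge0 beta_gt0 A_gt0 k_gt0 erefl t12 t1p.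
  rewrite -/(l2_mass k a) (_ : _ * _ * (l2_mass k a *+ _) = W); last first.
    by rewrite /W -[_ *+ #|_|]mulr_natr; ring.
  apply: le_trans; rewrite le_eqVlt; apply/orP; left; apply/eqP.
  congr (_ * _); rewrite -sum1_card natr_sum [RHS]big_mkcond; apply: eq_bigr => y _.
  by rewrite inE !coarse_sum_leaf /m le_min; case: (_ && _).
apply: le_trans (_ : \sum_y (s ^+ 6 + \sum_(j < k)
    (s * p%:R ^+ j.+1) ^+ 6 * (s * p%:R ^+ j <= m y)%R%:R) <= _).
  by apply: ler_sum => y _; apply: (@pow6_le_levels R p%:R s (m y) k); rewrite ?(ltW p0) ?m_ge0 ?m_le.
rewrite big_split /= sumr_const exchange_big /=.
apply: le_trans (_ : s ^+ 6 *+ #|{: G}| + \sum_(j < k) p%:R ^+ 6 * W <= _).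
  by rewrite lerD2l; apply: ler_sum => j _; rewrite -mulr_sumr weak.
rewrite sumr_const card_ord -[s ^+ 6 *+ _]mulr_natr -[_ * W *+ _]mulr_natr /W /bilinear_const.
rewrite -[X in s ^+ X]/(2 * 3)%N exprM s2 le_eqVlt; apply/orP; left; apply/eqP; ring.
Qed.

(** The Galilean symmetry carrying the arc [t + p * m] of the parabola to the whole parabola of
    stage [i.+1]. *)
Definition shear (i t : nat) (y : G) : G := (y.1 + (2 * t * p ^ i)%:R * y.2, y.2).

Lemma shear_inj i t : injective (shear i t).
Proof.
move=> [x1 y1] [x2 y2] /eqP; rewrite xpair_eqE /= => /andP[/eqP x12 /eqP y12].
by move: x12; rewrite y12 => /addIr ->.
Qed.

Lemma chi_rescale i t m y :
  chi p i e (t + p * m) y = chi p i e t y * chi p i.+1 e m (shear i t y).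
Proof.
by rewrite /chi /shear -eD /= expnSr !natrD !natrM; congr e; ring.
Qed.

Lemma sum_class_sum_pow6 i k a t : (t < p)%N ->
  \sum_y normc (class_sum i k.+1 a t y) ^+ 6 =
  \sum_y normc (\sum_(m < p ^ k) a (t + p * m)%N * chi p i.+1 e m y) ^+ 6.
Proof.
move=> tp; rewrite [RHS](reindex_inj (@shear_inj i t)) /=.
apply: eq_bigr => y _; congr (_ ^+ 6).
have modE t' m : ((t' + p * m) %% p = t' %% p)%N by rewrite addnC mulnC modnMDl.
rewrite /class_sum big_mkcond expnS.
rewrite (sum_digits _ _ (fun c => if (c %% p == t)%N then a c * chi p i e c y else 0)).
rewrite (bigD1 (Ordinal tp)) //= [X in _ + X]big1 ?addr0 => [|t' tt'].
  under eq_bigr => m _ do rewrite modE modn_small // eqxx chi_rescale mulrCA.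
  by rewrite -mulr_sumr normcM chi_norm // mul1r.
rewrite big1 // => m _; rewrite modE modn_small //.
by case: eqP => // t'E; case/eqP: tt'; exact: val_inj.
Qed.

Lemma l2_mass_digits k a : l2_mass k.+1 a = \sum_(t < p) l2_mass k (fun m => a (t + p * m)%N).
Proof. by rewrite /l2_mass expnS (sum_digits _ _ (fun c => normc (a c) ^+ 2)). Qed.

Lemma sum_pow3_le (n : nat) (u : 'I_n -> R) : (forall t, 0 <= u t) ->
  \sum_t u t ^+ 3 <= (\sum_t u t) ^+ 3.
Proof.
move=> u0; have S0 : 0 <= \sum_t u t by exact: sumr_ge0.
rewrite [leRHS]exprSr mulr_sumr; apply: ler_sum => t _; rewrite exprSr.
rewrite ler_wpM2r // lerXn2r ?nnegrE // (bigD1 t) //= lerDl sumr_ge0 //.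
Qed.

(** Induction on [k] with [i + k = K], so that rescaling stays in the same group. A narrow step
    multiplies by [(1 + L^-1) ^+ 6], with the masses of the classes recombined by [sum_pow3_le]; a
    broad step adds [Q]. *)
Lemma finite_restriction (L Q : R) (K : nat) : 0 < L -> q = (p ^ (2 * K))%N ->
  (forall k, (k <= K)%N ->
     (p%:R ^+ 2 * L) ^+ 6 * (p%:R ^+ 2 * bilinear_const k) <= Q) ->
  forall k i (a : nat -> R[i]), (i + k = K)%N ->
  \sum_y normc (\sum_(c < p ^ k) a c * chi p i e c y) ^+ 6 <=
  (1 + L^-1) ^+ (6 * k) * (1 + k%:R * Q) * l2_mass k a ^+ 3 * #|{: G}|%:R.
Proof.
move=> L_gt0 qE QP; elim=> [|k IH] i a ikK.
  rewrite muln0 mul0r addr0 !mul1r /l2_mass expn0 big_ord1.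
  under eq_bigr => y _ do rewrite big_ord1 normcM chi_norm // mulr1.
  by rewrite sumr_const -exprM mulr_natr.
have split_parts y : \sum_(c < p ^ k.+1) a c * chi p i e c y = \sum_(t < p) class_sum i k.+1 a t y.
  rewrite (partition_big (fun c : 'I_(p ^ k.+1) => Ordinal (ltn_pmod c (prime_gt0 p_prime))) xpredT) //=.
under eq_bigr => y _ do rewrite split_parts.
apply: le_trans (ler_sum _ (fun y _ => broad_narrow (fun t : 'I_p => class_sum i k.+1 a t y) L_gt0)) _.
rewrite big_split /= -!mulr_sumr.
set S := l2_mass k.+1 a; set N := #|_|%:R.
have N_ge0 : 0 <= N by [].
have Q_ge0 : 0 <= Q.
  apply: le_trans (QP 0%N isT).
  have pX n : 0 <= p%:R ^+ n :> R by rewrite exprn_ge0.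
  exact: mulr_ge0 (exprn_ge0 _ (mulr_ge0 (pX _) (ltW L_gt0))) (mulr_ge0 (pX _) (bilinear_const_ge0 _)).
have narrow : \sum_y \sum_(t < p) normc (class_sum i k.+1 a t y) ^+ 6 <=
    (1 + L^-1) ^+ (6 * k) * (1 + k%:R * Q) * S ^+ 3 * N.
  rewrite exchange_big /=.
  under eq_bigr => t _ do rewrite sum_class_sum_pow6 //.
  have ik' : (i.+1 + k = K)%N by lia.
  apply: le_trans (_ : \sum_(t < p) (1 + L^-1) ^+ (6 * k) * (1 + k%:R * Q) *
      l2_mass k (fun m => a (t + p * m)%N) ^+ 3 * N <= _).
    by apply: ler_sum => t _; exact: IH ik'.
  rewrite -mulr_suml -mulr_sumr; apply: ler_wpM2r => //; apply: ler_wpM2l.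
    by rewrite mulr_ge0 ?exprn_ge0 ?addr_ge0 ?mulr_ge0 ?invr_ge0 ?(ltW L_gt0).
  by rewrite /S l2_mass_digits; apply: sum_pow3_le => t; exact: l2_mass_ge0.
have broad : (p%:R ^+ 2 * L) ^+ 6 * (\sum_y \sum_(t1 < p) \sum_(t2 < p | t2 != t1)
    Num.min (normc (class_sum i k.+1 a t1 y)) (normc (class_sum i k.+1 a t2 y)) ^+ 6) <= Q * S ^+ 3 * N.
  pose X := bilinear_const k.+1 * S ^+ 3 * N.
  apply: le_trans (_ : (p%:R ^+ 2 * L) ^+ 6 * (p%:R ^+ 2 * X) <= _); last first.
    rewrite (_ : _ * (_ * X) =
      (p%:R ^+ 2 * L) ^+ 6 * (p%:R ^+ 2 * bilinear_const k.+1) * S ^+ 3 * N);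
      last by rewrite /X; ring.
    rewrite ler_wpM2r // ler_wpM2r ?exprn_ge0 ?l2_mass_ge0 //; apply: QP; lia.
  apply: ler_wpM2l.
    by rewrite exprn_ge0 // mulr_ge0 ?exprn_ge0 // ltW.
  have X_ge0 : 0 <= X.
    by rewrite !mulr_ge0 ?exprn_ge0 ?l2_mass_ge0 ?bilinear_const_ge0.
  have -> : p%:R ^+ 2 * X = \sum_(t1 < p) \sum_(t2 < p) X.
    by rewrite !sumr_const !card_ord -mulrnA -[RHS]mulr_natl natrM expr2.
  rewrite exchange_big; apply: ler_sum => t1 _.
  rewrite exchange_big [leLHS]big_mkcond; apply: ler_sum => t2 _; case: ifP => // t21.
  by apply: bilinear_le; rewrite ?ikK // eq_sym.
apply: le_trans (lerD (ler_wpM2l _ narrow) broad) _.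
  by rewrite exprn_ge0 // addr_ge0 // invr_ge0 ltW.
pose B := 1 + L^-1; rewrite -/B.
have B_ge1 : 1 <= B by rewrite lerDl invr_ge0 ltW.
have T_ge0 : 0 <= S ^+ 3 * N by rewrite mulr_ge0 // exprn_ge0 // l2_mass_ge0.
apply: le_trans (_ : (B ^+ (6 * k.+1) * (1 + k%:R * Q) + Q) * (S ^+ 3 * N) <= _).
  by rewrite le_eqVlt; apply/orP; left; apply/eqP; rewrite mulnS exprD; ring.
rewrite -[leRHS]mulrA; apply: ler_wpM2r => //.
rewrite -natr1 mulrDl mul1r addrA [leRHS]mulrDr lerD2l.
by rewrite -[leLHS]mul1r ler_wpM2r // exprn_ege1.
Qed.

End FiniteRestriction.

(** * Choice of constants for [p = 3] *)

Lemma one_add_exp_le (R : realFieldType) (u : R) (n : nat) :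
  0 <= u -> 2 * n%:R * u <= 1 -> (1 + u) ^+ n <= 1 + 2 * n%:R * u.
Proof.
move=> u0; elim: n => [|n IH] nu; first by rewrite !(mulr0, mul0r) addr0.
rewrite -natr1 in nu *.
have n0 : 0 <= n%:R :> R by [].
have nu' : 2 * n%:R * u <= 1 by nra.
rewrite exprSr; apply: le_trans (_ : (1 + 2 * n%:R * u) * (1 + u) <= _).
  by rewrite ler_wpM2r ?addr_ge0 // IH.
nra.
Qed.

(* [9 * (12 * K) = 108 * K] is the broad-narrow constant [p ^ 2 * L] with [L = 12 * K]; the
   factor [2] bounds [(1 + 1 / L) ^ (6 * K)]. *)
Definition restriction_const (R : pzRingType) : R :=
  2 * (1 + 108 ^+ 6 * (9 * (1 + 3 ^+ 6 * (256 + 2048 * 3 ^+ 4)))).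

Lemma restriction_const_gt0 (R : numDomainType) : 0 < restriction_const R.
Proof.
have X_ge0 m n : 0 <= m%:R ^+ n :> R by rewrite exprn_ge0.
apply: mulr_gt0; first exact: ltr0n.
apply: ltr_wpDr ltr01; apply: mulr_ge0 (X_ge0 _ _) (mulr_ge0 (ler0n _ _) _).
apply: addr_ge0 ler01 (mulr_ge0 (X_ge0 _ _) (addr_ge0 (ler0n _ _) _)).
exact: mulr_ge0 (ler0n _ _) (X_ge0 _ _).
Qed.

(** The exponent is [13 = 1 + 6 + 6]: the number of rescalings, the factor [L ^+ 6] with
    [L = 12 * K], and the bilinear constant. *)
Lemma finite_restriction3 (R : rcfType) (q K : nat) (e : 'Z_q -> R[i]) (a : nat -> R[i]) :
  (1 < q)%N -> q = (3 ^ (2 * K))%N -> (0 < K)%N ->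
  (forall x y, e (x + y) = e x * e y) -> (forall x, normc (e x) = 1) ->
  (forall x, e x = 1 -> x = 0) ->
  \sum_y normc (\sum_(c < 3 ^ K) a c * chi 3 0 e c y) ^+ 6 <=
  restriction_const R * K%:R ^+ 13 * l2_mass 3 K a ^+ 3 * #|{: 'Z_q * 'Z_q}|%:R.
Proof.
move=> q_gt1 qE K_gt0 eD e_norm e_inj.
have K1 : 1 <= K%:R :> R by rewrite ler1n.
have K0 : 0 < K%:R :> R by rewrite ltr0n.
pose c1 : R := 1 + 3 ^+ 6 * (256 + 2048 * 3 ^+ 4).
have X_ge0 m n : 0 <= m%:R ^+ n :> R by rewrite exprn_ge0.
have c1_ge0 : 0 <= c1.
  apply: addr_ge0 ler01 (mulr_ge0 (X_ge0 _ _) (addr_ge0 (ler0n _ _) _)).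
  exact: mulr_ge0 (ler0n _ _) (X_ge0 _ _).
have bil k : (k <= K)%N -> bilinear_const R 3 k <= c1 * K%:R ^+ 6.
  move=> kK; have kR : k%:R <= K%:R :> R by rewrite ler_nat.
  rewrite /bilinear_const /c1 [leRHS]mulrDl mul1r lerD //; first by rewrite exprn_ege1.
  rewrite (_ : _ * K%:R ^+ 6 = K%:R * 3 ^+ 6 * (256 * K%:R ^+ 5 + 2048 * 3 ^+ 4 * K%:R ^+ 5));
    last by ring.
  apply: ler_pM.
  - exact: mulr_ge0 (ler0n _ _) (X_ge0 _ _).
  - exact: addr_ge0 (ler0n _ _) (mulr_ge0 (mulr_ge0 (ler0n _ _) (X_ge0 _ _)) (X_ge0 _ _)).
  - exact: ler_wpM2r (X_ge0 _ _) _ _ kR.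
  apply: lerD.
    rewrite -[leLHS]mulr1; apply: ler_wpM2l; first exact: ler0n.
    exact: exprn_ege1.
  apply: ler_wpM2l; first exact: mulr_ge0 (ler0n _ _) (X_ge0 _ _).
  by rewrite lerXn2r ?nnegrE.
pose L : R := 12 * K%:R.
have L0 : 0 < L by rewrite mulr_gt0.
pose Q : R := (9 * L) ^+ 6 * (9 * (c1 * K%:R ^+ 6)).
have QP k : (k <= K)%N -> (3 ^+ 2 * L) ^+ 6 * (3 ^+ 2 * bilinear_const R 3 k) <= Q.
  move=> kK; rewrite /Q (_ : 3 ^+ 2 = 9 :> R); last by rewrite -natrX.
  by rewrite !ler_wpM2l ?bil // exprn_ge0 // mulr_ge0 // ltW.
apply: le_trans (finite_restriction (p := 3) isT isT q_gt1 eD e_norm e_inj L0 qE QP _ (add0n K)) _.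
have S0 : 0 <= l2_mass 3 K a ^+ 3 by rewrite exprn_ge0 // l2_mass_ge0.
rewrite ler_wpM2r // ler_wpM2r //.
apply: le_trans (_ : 2 * (1 + K%:R * Q) <= _).
  apply: ler_wpM2r.
    apply: addr_ge0 ler01 (mulr_ge0 (ler0n _ _) (mulr_ge0 (exprn_ge0 _ _) _)).
      exact: mulr_ge0 (ler0n _ _) (ltW L0).
    exact: mulr_ge0 (ler0n _ _) (mulr_ge0 c1_ge0 (X_ge0 _ _)).
  have KL : 2 * (6 * K)%:R * L^-1 = 1.
    by rewrite /L natrM; field; rewrite lt0r_neq0.
  apply: le_trans (one_add_exp_le _ _) _; rewrite ?KL ?invr_ge0 ?(ltW L0) //.
rewrite /restriction_const -/c1 -mulrA ler_wpM2l // [leRHS]mulrDl mul1r lerD //.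
  by rewrite exprn_ege1.
by rewrite le_eqVlt; apply/orP; left; apply/eqP; rewrite /Q /L; ring.
Qed.

From mathcomp Require Import all_classical all_reals all_analysis.
From mathcomp Require Import measurable_realfun.

Import numFieldNormedType.Exports.

Local Open Scope classical_set_scope.
Local Open Scope ring_scope.

(** * From the finite group to the torus *)

Section Grid.
Variable R : realType.
Local Notation mu := (@lebesgue_measure R).
Local Open Scope ereal_scope.

(** By uniqueness of Lebesgue measure it is enough to compare half-open intervals. *)
Lemma lebesgue_measure_shift (c : R) (A : set R) : measurable A ->
  pushforward mu (fun x : measurableTypeR R => (x + c)%R : measurableTypeR R) A = mu A.
Proof.
move=> mA; apply/esym/lebesgue_measure_unique => //=.
  exact: measurable_funD.
move=> _ _ [[a b]] _ <- /=.
rewrite /pushforward.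
have -> : (fun x => (x + c)%R) @^-1` `]a, b]%classic = `](a - c)%R, (b - c)%R]%classic.
  by apply/seteqP; split => x /=; rewrite !in_itv /= ltrBlDr lerBrDr.
by rewrite !lebesgue_measure_itv /= !lte_fin ltrD2r -!EFinB; congr (if _ then _%:E else _); ring.
Qed.

Lemma integral_shift (h c : R) (g : R -> \bar R) :
  measurable_fun [set: R] g -> (forall x, 0 <= g x) ->
  \int[mu]_(x in `[c, (c + h)%R[) g x = \int[mu]_(x in `[0%R, h[) g (x + c)%R.
Proof.
move=> mg g0.
pose phi (x : measurableTypeR R) : measurableTypeR R := (x + c)%R.
have mphi : measurable_fun [set: measurableTypeR R] phi by exact: measurable_funD.
have -> : `[0%R, h[%classic = phi @^-1` `[c, (c + h)%R[%classic.
  apply/seteqP; split => x /=; rewrite !in_itv /= /phi lerDr [in (x + c)%R]addrC ltrD2l //.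
rewrite -[RHS](@ge0_integral_pushforward _ _ _ _ R phi mphi mu _ g) //; last first.
  exact: measurable_funS mg.
by apply: eq_measure_integral => A mA _; rewrite -[LHS](lebesgue_measure_shift c mA).
Qed.

Lemma integral_grid (h : R) (m : nat) (g : R -> \bar R) : (0 <= h)%R ->
  measurable_fun [set: R] g -> (forall x, 0 <= g x) ->
  \int[mu]_(x in `[0%R, (m%:R * h)%R[) g x =
  \int[mu]_(x in `[0%R, h[) \sum_(u < m) g (x + u%:R * h)%R.
Proof.
move=> h0 mg g0.
have mshift c : measurable_fun [set: R] (fun x => g (x + c)%R).
  apply: measurableT_comp => //; exact: measurable_funD.
elim: m => [|m IH].
  rewrite mul0r set_itvco0 integral_set0 integral0_eq // => x _; by rewrite big_ord0.
under [RHS]eq_integral => x _ do rewrite big_ord_recr /=.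
rewrite ge0_integralD //=.
- rewrite -IH -integral_shift // -ge0_integral_setU //=.
  + congr (integral _ _ _); apply/seteqP; split => x /=; rewrite !in_itv /=.
      case: (ltP x (m%:R * h)%R) => xm /andP[x0 x1]; [left|right]; rewrite ?x0 //=.
      by rewrite -natr1 mulrDl mul1r in x1.
    move=> [|] /andP[x0 x1]; apply/andP; split => //.
    * by apply: lt_le_trans x1 _; rewrite ler_wpM2r // ler_nat.
    * by apply: le_trans x0; rewrite mulr_ge0.
    * by rewrite -natr1 mulrDl mul1r.
  + exact: measurable_funS mg.
  + apply/disj_setPS => x [/=]; rewrite !in_itv /= => /andP[_ x1] /andP[x2 _].
    by move: x1; rewrite ltNge x2.
- by move=> x _; apply: sume_ge0.
- by apply: measurable_funTS; apply: emeasurable_sum => u; exact: mshift.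
- exact: measurable_funTS (mshift _).
Qed.

End Grid.

(** * Bounding torus integrals by grid averages *)

Section TorusIntegral.
Variable R : realType.
Local Notation mu := (@lebesgue_measure R).
Local Open Scope ereal_scope.

Lemma integral_torus2 (f : measurableTypeR R * measurableTypeR R -> \bar R) :
  measurable_fun setT f -> (forall z, 0 <= f z) ->
  \int[@torus2_measure R]_z f z =
  \int[mu]_(x in `[0%R, 1%R[) \int[mu]_(t in `[0%R, 1%R[) f (x, t).
Proof.
move=> mf f0; set D := `[0%R, 1%R[%classic `*` `[0%R, 1%R[%classic : set (measurableTypeR R * measurableTypeR R).
have mD : measurable D by exact: measurable_unit_square.
have -> : \int[@torus2_measure R]_z f z = \int[(mu \x mu)%E]_(z in D) f z.
  rewrite -(setUv D) ge0_integral_setU //; last 3 first.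
  - exact: measurableC.
  - by rewrite setUv.
  - by apply/disj_setPCl.
  have -> : \int[@torus2_measure R]_(z in ~` D) f z = 0.
    apply: null_set_integral; [exact: measurableC|exact: measurable_funTS|].
    transitivity ((mu \x mu)%E (~` D `&` D)); first by [].
    by rewrite setICl measure0.
  rewrite adde0.
  apply: eq_measure_integral => A mA AD.
  transitivity ((mu \x mu)%E (A `&` D)); first by [].
  by congr ((mu \x mu)%E _); exact: setIidl.
rewrite integral_mkcond fubini_tonelli1; first last.
- by move=> z; rewrite patchE; case: ifP.
- by apply/(measurable_restrictT _ mD); exact: measurable_funTS.
rewrite [RHS]integral_mkcond; apply: eq_integral => x _.
rewrite /fubini_F patchE; case: ifPn => xI.
  rewrite [RHS]integral_mkcond; apply: eq_integral => t _.
  rewrite !patchE; congr (if _ then _ else _); apply/idP/idP; rewrite !inE /D /=.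
    by case.
  by move=> ?; split => //; rewrite inE in xI.
rewrite integral0_eq // => t _; rewrite patchE; case: ifPn => //.
by rewrite inE => -[/= xI' _]; rewrite notin_setE in xI.
Qed.

(** Folding both variables onto [[0, 1/q[] turns the integral into one of the grid sum over a square
    of area [q ^- 2]. *)
Lemma integral_torus2_le (q : nat) (B : R)
    (f : measurableTypeR R * measurableTypeR R -> \bar R) : (0 < q)%N -> (0 <= B)%R ->
  measurable_fun setT f -> (forall z, 0 <= f z) ->
  (forall x t : R, \sum_(u < q) \sum_(v < q)
     f ((x + u%:R / q%:R)%R, (t + v%:R / q%:R)%R) <= (B * q%:R ^+ 2)%:E) ->
  \int[@torus2_measure R]_z f z <= B%:E.
Proof.
move=> q_gt0 B0 mf f0 fB; rewrite integral_torus2 //.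
have qR : (0 < q%:R :> R)%R by rewrite ltr0n.
set h : R := (q%:R^-1)%R; have h0 : (0 <= h)%R by rewrite invr_ge0 ltW.
have qh : (q%:R * h = 1)%R by rewrite divff // lt0r_neq0.
pose F x := \int[mu]_(t in `[0%R, h[) \sum_(v < q) f (x, t + v%:R * h)%R.
have mfx c d : measurable_fun [set: measurableTypeR R * measurableTypeR R]
    (fun z => f ((z.1 + c)%R, (z.2 + d)%R)).
  apply: measurableT_comp => //; apply: measurable_fun_pair => /=.
    exact: measurable_funD.
  exact: measurable_funD.
have mft x d : measurable_fun [set: measurableTypeR R] (fun t => f (x, (t + d)%R)).
  apply: measurableT_comp => //; apply: measurable_fun_pair => //=.
  exact: measurable_funD.
have gridE x : \int[mu]_(t in `[0%R, 1%R[) f (x, t) = F x.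
  rewrite -[in LHS]qh integral_grid //.
  by have := mft x 0%R; under eq_fun do rewrite addr0.
have F0 x : 0 <= F x.
  by apply: integral_ge0 => t _; apply: sume_ge0.
have mI : measurable (`[0%R, h[ : set (measurableTypeR R)) by [].
(* [F] is the partial integral of a nonnegative measurable function on the plane, so Tonelli gives
   measurability. *)
have mF : measurable_fun [set: R] F.
  pose g (z : measurableTypeR R * measurableTypeR R) :=
    ((fun z => \sum_(v < q) f (z.1, z.2 + v%:R * h)%R) \_ (setT `*` `[0%R, h[)) z.
  have mTI : measurable (setT `*` `[0%R, h[ : set (measurableTypeR R * measurableTypeR R)).
    exact: measurableX.
  have -> : F = fubini_F mu g.
    apply/funext => x; rewrite /F /fubini_F [LHS]integral_mkcond; apply: eq_integral => t _.
    rewrite /g !patchE; congr (if _ then _ else _); apply/idP/idP; rewrite !inE /=.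
      by split.
    by case.
  apply: measurable_fun_fubini_tonelli_F; last first.
    by move=> z; rewrite /g patchE; case: ifP => // _; apply: sume_ge0.
  apply/(measurable_restrictT _ mTI); apply: measurable_funTS.
  apply: emeasurable_sum => v; have := mfx 0%R (v%:R * h)%R.
  by under eq_fun do rewrite addr0.
under eq_integral => x _ do rewrite gridE.
rewrite -[in leLHS]qh integral_grid //.
have mFc c : measurable_fun [set: R] (fun x => F (x + c)%R).
  by apply: measurableT_comp => //; exact: measurable_funD.
have muI : mu `[0%R, h[ = h%:E.
  rewrite lebesgue_measure_itv /= lte_fin; case: ltP => h1; rewrite ?sube0 //.
  by have /eqP -> : (h == 0)%R by rewrite eq_le h1 h0.
have cstE c : \int[mu]_(t in `[0%R, h[) (cst c t) = c * h%:E.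
  by rewrite -muI; exact: integral_cst.
apply: (@le_trans _ _ ((B * q%:R)%:E * h%:E)); last first.
  by rewrite -EFinM lee_fin -mulrA qh mulr1.
rewrite -(cstE (B * q%:R)%:E).
apply: ge0_le_integral => //=.
- by move=> x _; apply: sume_ge0.
- by apply: measurable_funTS; apply: emeasurable_sum => u; exact: mFc.
move=> x _; rewrite /F -ge0_integral_sum //; last 2 first.
  - move=> u; apply: measurable_funTS; apply: emeasurable_sum => v; exact: mft.
  - by move=> u t _; apply: sume_ge0.
  apply: (@le_trans _ _ ((B * q%:R ^+ 2)%:E * h%:E)).
    rewrite -(cstE (B * q%:R ^+ 2)%:E).
    apply: ge0_le_integral => //=.
    - by move=> t _; apply: sume_ge0 => u _; apply: sume_ge0.
    apply: measurable_funTS; apply: emeasurable_sum => u.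
    by apply: emeasurable_sum => v; exact: mft.
  rewrite -EFinM lee_fin.
  by rewrite expr2 -!mulrA qh mulr1.
Qed.

End TorusIntegral.

(** * The exponential as a faithful character of ['Z_q] *)

Section CircleCharacter.
Variable R : realType.

Lemma expi2piD (x y : R) : expi2pi (x + y) = expi2pi x * expi2pi y.
Proof. by rewrite /expi2pi mulrDr cosD sinD; congr Complex; rewrite addrC. Qed.

Lemma normc_expi2pi (x : R) : normc (expi2pi x) = 1.
Proof. by rewrite /normc /= cos2Dsin2 sqrtr1. Qed.

Lemma expi2pi0 : expi2pi (0 : R) = 1.
Proof. by rewrite /expi2pi mulr0 cos0 sin0. Qed.

Lemma expi2pi_nat (n : nat) : expi2pi (n%:R : R) = 1.
Proof.
elim: n => [|n IH]; first exact: expi2pi0.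
rewrite -natr1 expi2piD IH mul1r /expi2pi mulr1 mulr_natl cos2pi.
by rewrite mulr2n sinD sinpi mul0r mulr0 addr0.
Qed.

(** The double angle formula forces [sin (pi * x) = 0], but the sine is positive inside []0,
    pi[]. *)
Lemma expi2pi_eq1 (x : R) : 0 <= x < 1 -> expi2pi x = 1 -> x = 0.
Proof.
move=> /andP[x0 x1] [cosE _]; apply/eqP; rewrite eq_le x0 andbT leNgt.
apply/negP => x_gt0; have pi0 := pi_gt0 R.
have : 0 < sin (pi * x).
  by apply: sin_gt0_pi; rewrite mulr_gt0 //= -[ltRHS]mulr1 ltr_pM2l.
have cs := cos2Dsin2 (pi * x).
move: cosE; rewrite (_ : 2 * pi * x = pi * x + pi * x); last by ring.
rewrite cosD => cosE; nra.
Qed.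

Variable q : nat.
Hypothesis q_gt1 : (1 < q)%N.

Definition zq_char (z : 'Z_q) : R[i] := expi2pi ((val z)%:R / q%:R).

Let qR : q%:R != 0 :> R. Proof. by rewrite pnatr_eq0; lia. Qed.

Lemma zq_char_nat (n : nat) : zq_char n%:R = expi2pi (n%:R / q%:R).
Proof.
rewrite /zq_char /= val_Zp_nat // [in RHS](divn_eq n q) natrD natrM mulrDl mulfK //.
by rewrite expi2piD expi2pi_nat mul1r.
Qed.

Lemma zq_charD (x y : 'Z_q) : zq_char (x + y) = zq_char x * zq_char y.
Proof.
rewrite -[in LHS](natr_Zp x) -[in LHS](natr_Zp y) -natrD zq_char_nat natrD mulrDl.
exact: expi2piD.
Qed.

Lemma normc_zq_char (x : 'Z_q) : normc (zq_char x) = 1.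
Proof. exact: normc_expi2pi. Qed.

Lemma zq_char_inj (x : 'Z_q) : zq_char x = 1 -> x = 0.
Proof.
have q0 : 0 < q%:R :> R by rewrite ltr0n; lia.
have xq : (val x < q)%N by have := ltn_ord x; rewrite [X in (_ < X)%N -> _]Zp_cast.
move/expi2pi_eq1 => /(_ _)/eqP; rewrite divr_ge0 //= ltr_pdivrMr // mul1r ltr_nat xq.
move/(_ isT); rewrite mulf_eq0 invr_eq0 (negPf qR) orbF pnatr_eq0 => /eqP x0.
by rewrite -(natr_Zp x) x0.
Qed.

Lemma zq_char_int (m : int) : zq_char m%:~R = expi2pi (m%:~R / q%:R).
Proof.
case: m => n; first by rewrite -!pmulrn zq_char_nat.
have e1 : zq_char (n.+1%:R) != 0.
  apply/eqP => char0; have := normc_zq_char n.+1%:R.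
  by rewrite char0 normc0 => /esym/eqP; rewrite oner_eq0.
apply: (mulIf e1); rewrite -zq_charD NegzE !mulrNz -!pmulrn addNr.
rewrite zq_char_nat -expi2piD mulNr addNr expi2pi0.
by rewrite -[0](mulr0n 1) zq_char_nat mul0r expi2pi0.
Qed.

Lemma sum_Zq (V : nmodType) (F : nat -> V) :
  \sum_(z : 'Z_q) F (val z) = \sum_(u < q) F u.
Proof. by rewrite -(big_mkord xpredT F) Zp_cast // big_mkord. Qed.

End CircleCharacter.

(** * The exponential sum on a translated grid *)

Section GridBound.
Variable R : realType.
Variables (N K q : nat).
Hypotheses (q_gt1 : (1 < q)%N) (qE : q = (3 ^ (2 * K))%N) (K_gt0 : (0 < K)%N).
Hypothesis NK : (N.*2 < 3 ^ K)%N.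
Local Notation G := ('Z_q * 'Z_q)%type.

Lemma sum_freqs (V : nmodType) (F : int -> V) :
  \sum_(n <- freqs N) F n = \sum_(k < N.*2.+1) F (k%:Z - N%:Z).
Proof. by rewrite /freqs big_map -{1}[N.*2.+1]subn0 -/(index_iota 0 _) big_mkord. Qed.

(* Shifting the frequencies [-N..N] to [0..2N] amounts to this Galilean change of variables. *)
Let galilei (y : G) : G := (y.1 - (2 * N)%:R * y.2, y.2).

Lemma galilei_inj : injective galilei.
Proof.
move=> [x1 y1] [x2 y2] /eqP; rewrite xpair_eqE /= => /andP[/eqP x12 /eqP y12].
by move: x12; rewrite y12 => /addIr ->.
Qed.

(** The base point [(x, t)] contributes only unimodular factors, absorbed here; zeros pad the
    [2 * N + 1] frequencies to [3 ^ K]. *)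
Let coeff (a : int -> R[i]) (x t : R) (k : nat) : R[i] :=
  if (k < N.*2.+1)%N then
    a (k%:Z - N%:Z) * expi2pi (k%:R * (x - 2 * N%:R * t) + k%:R ^+ 2 * t)
  else 0.

Lemma l2_mass_coeff a x t : l2_mass 3 K (coeff a x t) = l2norm N a ^+ 2.
Proof.
rewrite /l2norm sqr_sqrtr ?sum_sqr_ge0 // sum_freqs.
rewrite (big_ord_widen _ (fun k => normc (a (k%:Z - N%:Z)) ^+ 2) NK) big_mkcond.
apply: eq_bigr => k _; rewrite /coeff; case: ifP => _; last by rewrite normc0 expr0n.
by rewrite normcM normc_expi2pi mulr1.
Qed.

Lemma normc_quad_exp_sum_grid a (x t : R) (y : G) :
  normc (quad_exp_sum N a (x + (val y.1)%:R / q%:R, t + (val y.2)%:R / q%:R)) =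
  normc (\sum_(c < 3 ^ K) coeff a x t c * chi 3 0 (@zq_char R q) c (galilei y)).
Proof.
set u := val y.1; set v := val y.2.
(* The part of the phase at frequency [k - N] that does not depend on [k]. *)
pose w := expi2pi (- N%:R * (x + u%:R / q%:R) + N%:R ^+ 2 * (t + v%:R / q%:R)).
have -> : quad_exp_sum N a (x + u%:R / q%:R, t + v%:R / q%:R) =
    w * \sum_(c < 3 ^ K) coeff a x t c * chi 3 0 (@zq_char R q) c (galilei y).
  rewrite /quad_exp_sum sum_freqs.
  rewrite (big_ord_widen _ (fun k => a (k%:Z - N%:Z) * expi2pi
     ((k%:Z - N%:Z)%:~R * (x + u%:R / q%:R) + (k%:Z - N%:Z)%:~R ^+ 2 * (t + v%:R / q%:R))) NK).
  rewrite mulr_sumr big_mkcond; apply: eq_bigr => k _.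
  rewrite /coeff; case: ifP => _; last by rewrite mul0r mulr0.
  have -> : chi 3 0 (@zq_char R q) k (galilei y) =
      @zq_char R q (k%:Z * (u%:Z - 2 * N%:Z * v%:Z) + k%:Z ^+ 2 * v%:Z)%:~R.
    rewrite /chi /galilei /= expn0 !mul1r; congr zq_char.
    rewrite !(rmorphD, rmorphM, rmorphN, rmorphXn) /= -!pmulrn.
    by rewrite /u /v !natr_Zp; ring.
  rewrite zq_char_int // mulrCA -!mulrA; congr (_ * _).
  rewrite -!expi2piD; congr expi2pi.
  rewrite !(rmorphD, rmorphM, rmorphN, rmorphXn) /= -!pmulrn; ring.
by rewrite normcM normc_expi2pi mul1r.
Qed.

Lemma grid_bound a (x t : R) :
  \sum_(u < q) \sum_(v < q)
    normc (quad_exp_sum N a (x + u%:R / q%:R, t + v%:R / q%:R)) ^+ 6 <=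
  restriction_const R * K%:R ^+ 13 * l2norm N a ^+ 6 * q%:R ^+ 2.
Proof.
pose F u v := normc (quad_exp_sum N a (x + u%:R / q%:R, t + v%:R / q%:R)) ^+ 6.
have -> : \sum_(u < q) \sum_(v < q)
    normc (quad_exp_sum N a (x + u%:R / q%:R, t + v%:R / q%:R)) ^+ 6 =
    \sum_(y : G) normc (\sum_(c < 3 ^ K) coeff a x t c * chi 3 0 (@zq_char R q) c y) ^+ 6.
  rewrite [RHS](reindex_inj galilei_inj) /=.
  under [RHS]eq_bigr => y _ do rewrite -normc_quad_exp_sum_grid.
  rewrite -(sum_Zq q_gt1 (fun u => \sum_(v < q) F u v)).
  under [LHS]eq_bigr => z _ do rewrite -(sum_Zq q_gt1 (F (val z))).
  by rewrite pair_big.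
apply: le_trans (finite_restriction3 _ q_gt1 qE K_gt0 (zq_charD R q_gt1)
  (@normc_zq_char R q) (@zq_char_inj R q q_gt1)) _.
rewrite l2_mass_coeff -exprM card_prod card_ord Zp_cast // natrM expr2.
by [].
Qed.

End GridBound.

(** * Measurability of the integrand *)

Section Measurability.
Variable R : realType.
Local Notation T2 := (measurableTypeR R * measurableTypeR R)%type.

Lemma measurable_phase (F : R -> R) (c : R) (n : R) : continuous F ->
  measurable_fun [set: T2] (fun z => F (c * (n * z.1 + n ^+ 2 * z.2))).
Proof.
move=> cF; apply: (measurableT_comp (continuous_measurable_fun cF)).
apply: measurable_funM => //; apply: measurable_funD; apply: measurable_funM => //.
Qed.

Lemma measurable_normc_pow6 (N : nat) (a : int -> R[i]) :
  measurable_fun [set: T2] (fun z => (normc (quad_exp_sum N a z) ^+ 6)%:E).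
Proof.
apply/measurable_EFinP.
pose re z : R := \sum_(n <- freqs N) (complex.Re (a n) * cos (2 * pi * (n%:~R * z.1 + n%:~R ^+ 2 * z.2))
  - complex.Im (a n) * sin (2 * pi * (n%:~R * z.1 + n%:~R ^+ 2 * z.2))).
pose im z : R := \sum_(n <- freqs N) (complex.Re (a n) * sin (2 * pi * (n%:~R * z.1 + n%:~R ^+ 2 * z.2))
  + complex.Im (a n) * cos (2 * pi * (n%:~R * z.1 + n%:~R ^+ 2 * z.2))).
have sumE z : quad_exp_sum N a z = Complex (re z) (im z).
  rewrite /quad_exp_sum /re /im; elim: (freqs N) => [|n s IH]; first by rewrite !big_nil.
  by rewrite !big_cons IH; case: (a n).
have -> : (fun z => normc (quad_exp_sum N a z) ^+ 6) = (fun z => (re z ^+ 2 + im z ^+ 2) ^+ 3).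
  apply/funext => z; rewrite sumE /normc -[X in _ ^+ X]/(2 * 3)%N exprM sqr_sqrtr //.
  by rewrite addr_ge0 ?sqr_ge0.
have mcos n := measurable_phase (2 * pi) n (@continuous_cos R).
have msin n := measurable_phase (2 * pi) n (@continuous_sin R).
apply: measurable_funX; apply: measurable_funD; apply: measurable_funX; apply: measurable_sum => n.
  by apply: measurable_funB; apply: measurable_funM.
by apply: measurable_funD; apply: measurable_funM.
Qed.

End Measurability.

(** * The sixth root and the choice of [K] *)

Lemma torus2_L6_le (R : realType) (N K : nat) (a : int -> R[i]) :
  (0 < K)%N -> (N.*2 < 3 ^ K)%N ->
  (torus2_Lnorm 6 (quad_exp_sum N a) <=
   ((restriction_const R * K%:R ^+ 13) `^ 6^-1 * l2norm N a)%:E)%E.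
Proof.
move=> K_gt0 NK; set M := restriction_const R * _.
have l2_ge0 : 0 <= l2norm N a by exact: sqrtr_ge0.
have M_ge0 : 0 <= M by rewrite mulr_ge0 ?exprn_ge0 ?ler0n ?(ltW (restriction_const_gt0 R)).
pose q := (3 ^ (2 * K))%N.
have q_gt1 : (1 < q)%N by rewrite -(expn0 3) ltn_exp2l // muln_gt0.
have int_le : (\int[@torus2_measure R]_z (normc (quad_exp_sum N a z) ^+ 6)%:E
    <= (M * l2norm N a ^+ 6)%:E)%E.
  apply: (@integral_torus2_le R q) => //.
  - by lia.
  - by rewrite mulr_ge0 ?exprn_ge0.
  - exact: measurable_normc_pow6.
  - by move=> z; rewrite lee_fin exprn_ge0 // normc_ge0.
  move=> x t; under eq_bigr => u _ do rewrite sumEFin.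
  by rewrite sumEFin lee_fin; exact: grid_bound.
rewrite /torus2_Lnorm unlock /=.
under eq_integral => z _ do
  rewrite /= ger0_norm ?normc_ge0 // powR_mulrn ?normc_ge0 //.
have -> : M `^ 6^-1 * l2norm N a = (M * l2norm N a ^+ 6) `^ 6^-1.
  rewrite [RHS]powRM ?exprn_ge0 //; congr (_ * _).
  by rewrite -powR_mulrn // -powRrM divff ?powRr1 // pnatr_eq0.
rewrite -poweR_EFin; apply: gt0_ler_poweR => //.
- by rewrite in_itv /= leey andbT; apply: integral_ge0 => z _; rewrite lee_fin exprn_ge0 // normc_ge0.
- by rewrite in_itv /= lee_fin leey andbT mulr_ge0 ?exprn_ge0.
Qed.

Theorem corollary1p3 (R : realType) :
  exists c' C : R, 0 < c' /\ 0 < C /\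
    forall N : nat, (2 <= N)%N ->
      (strichartz_const (6 : R) N <= (C * (ln (N%:R : R)) `^ c')%:E)%E.
Proof.
have ln2 : 0 < ln (2 : R) by rewrite ln_gt0 // ltr1n.
pose D : R := restriction_const R * (3 / ln 2) ^+ 13.
have rc_gt0 := restriction_const_gt0 R.
(* The sixth root of [K ^ 13], with [K] bounded by [3 / ln 2 * ln N]. *)
exists (13 / 6), (D `^ 6^-1); split; first by rewrite divr_gt0.
split; first by rewrite powR_gt0 // mulr_gt0 // exprn_gt0 // divr_gt0.
(* Two extra digits give [2 * N < 2 ^ K <= 3 ^ K]; since [T >= 1], still [K <= 3 * T]. *)
move=> N N2; pose T := trunc_log 2 N; pose K := T.+2.
have T_gt0 : (0 < T)%N by rewrite trunc_log_gt0.
have NK : (N.*2 < 3 ^ K)%N.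
  have NT : (N < 2 ^ T.+1)%N by exact: trunc_log_ltn.
  apply: (@leq_trans (2 ^ K)%N); last by rewrite leq_exp2r.
  by rewrite /K expnS -mul2n ltn_pmul2l.
have lnN : 0 < ln (N%:R : R) by rewrite ln_gt0 // ltr1n.
have K_le : K%:R <= 3 / ln 2 * ln N%:R :> R.
  have Tln : T%:R * ln 2 <= ln N%:R :> R.
    rewrite mulr_natl -lnXn // ler_ln ?posrE ?exprn_gt0 ?ltr0n //; last by lia.
    by rewrite -natrX ler_nat trunc_logP //; lia.
  rewrite mulrAC ler_pdivlMr //; apply: le_trans (_ : 3 * (T%:R * ln 2) <= _); last first.
    by rewrite ler_wpM2l.
  by rewrite mulrA ler_wpM2r ?(ltW ln2) // -natrM ler_nat /K; lia.
apply: ereal_inf_lbound; exists (D `^ 6^-1 * ln N%:R `^ (13 / 6)) => // a.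
apply: le_trans (torus2_L6_le a (ltn0Sn _) NK) _.
rewrite lee_fin ler_wpM2r ?sqrtr_ge0 //.
have -> : ln N%:R `^ (13 / 6) = (ln N%:R ^+ 13) `^ 6^-1 :> R.
  by rewrite powRrM powR_mulrn // ltW.
have D_ge0 : 0 <= D by rewrite mulr_ge0 ?exprn_ge0 ?divr_ge0 // ltW.
rewrite -powRM ?exprn_ge0 ?(ltW lnN) //; apply: ge0_ler_powR.
- by rewrite invr_ge0.
- by rewrite nnegrE mulr_ge0 ?exprn_ge0 // ltW.
- by rewrite nnegrE mulr_ge0 ?exprn_ge0 // ltW.
have -> : D * ln N%:R ^+ 13 = restriction_const R * (3 / ln 2 * ln N%:R) ^+ 13.
  exact: etrans (esym (mulrA _ _ _)) (congr1 _ (esym (exprMn _ _ _))).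
apply: ler_wpM2l (ltW rc_gt0) _ _ _; rewrite lerXn2r ?nnegrE //.
by apply: le_trans K_le.
Qed.
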